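(* Let $\widehat{a}_1,\widehat{a}_2,\widehat{b}_1$ be dual numbers with $\Re(\widehat{b}_1)>\Re(\widehat{a}_1)+\Re(\widehat{a}_2)$ and such that none of $\Re(\widehat{b}_1)$, $\Re(\widehat{b}_1-\widehat{a}_1)$, $\Re(\widehat{b}_1-\widehat{a}_2)$ is in $\{0,-1,-2,\dots\}$. Then $${}_2F_1(\widehat{a}_1,\widehat{a}_2;\widehat{b}_1;1)=\frac{\Gamma_d(\widehat{b}_1)\,\Gamma_d(\widehat{b}_1-\widehat{a}_1-\widehat{a}_2)}{\Gamma_d(\widehat{b}_1-\widehat{a}_1)\,\Gamma_d(\widehat{b}_1-\widehat{a}_2)}.$$
   Context: Dual numbers are $\widehat{x}=x_1+\varepsilon x_2$, $x_1,x_2\in\mathbb{R}$, $\varepsilon^2=0$, forming the commutative ring $\mathbb{R}[\varepsilon]/(\varepsilon^2)$; $\Re(\widehat{x})=x_1$, and division by $\widehat{x}$ is possible iff $x_1\ne0$. The dual gamma function is $\Gamma_d(a+\varepsilon b)=\Gamma(a)+\varepsilon b\,\Gamma'(a)$ for $a\ne0,-1,-2,\dots$ (equal to $\int_0^\infty e^{-t}t^{a-1}(1+\varepsilon b\log t)\,dt$ when $a>0$). The dual shifted factorial is $(\widehat{a})_0=1$, $(\widehat{a})_k=\widehat{a}(\widehat{a}+1)\cdots(\widehat{a}+k-1)$ for $k\ge1$, and the dual Gauss hypergeometric function is ${}_2F_1(\widehat{a}_1,\widehat{a}_2;\widehat{b}_1;\widehat{x})=\sum_{k=0}^\infty\frac{(\widehat{a}_1)_k(\widehat{a}_2)_k(\widehat{x})^k}{(\widehat{b}_1)_k\,k!}$,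 convergence being in real and dual parts. *)

(* Defs.v *)
From HB Require Import structures.
From mathcomp Require Import all_boot all_order all_algebra.
From mathcomp Require Import all_classical all_reals all_analysis.
Set Implicit Arguments.
Unset Strict Implicit.
Unset Printing Implicit Defensive.
Import Order.TTheory GRing.Theory Num.Theory.
Import numFieldNormedType.Exports.
Local Open Scope classical_set_scope.
Local Open Scope ring_scope.

(* [Dual x1 x2] is the dual number x1 + eps x2, with eps ^+ 2 = 0. *)
Record dualnum (R : Type) := Dual { dual_re : R; dual_du : R }.

Section DualRing.
Variable F : fieldType.
Implicit Types x y z : dualnum F.

Definition dual_pair x := (dual_re x, dual_du x).
Definition pair_dual (p : F * F) := Dual p.1 p.2.
Lemma dual_pairK : cancel dual_pair pair_dual. Proof. by case. Qed.
HB.instance Definition _ := Equality.copy (dualnum F) (can_type dual_pairK).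
HB.instance Definition _ := Choice.copy (dualnum F) (can_type dual_pairK).

Definition dual_zero : dualnum F := Dual 0 0.
Definition dual_one : dualnum F := Dual 1 0.
Definition dual_opp x := Dual (- dual_re x) (- dual_du x).
Definition dual_add x y :=
  Dual (dual_re x + dual_re y) (dual_du x + dual_du y).
Definition dual_mul x y :=
  Dual (dual_re x * dual_re y) (dual_re x * dual_du y + dual_du x * dual_re y).

Lemma dual_addA : associative dual_add.
Proof. by move=> x y z; rewrite /dual_add /= !addrA. Qed.
Lemma dual_addC : commutative dual_add.
Proof. by move=> x y; rewrite /dual_add addrC (addrC (dual_du x)). Qed.
Lemma dual_add0 : left_id dual_zero dual_add.
Proof. by move=> [a b]; rewrite /dual_add /= !add0r. Qed.
Lemma dual_addN : left_inverse dual_zero dual_opp dual_add.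
Proof. by move=> x; rewrite /dual_add /= !addNr. Qed.
HB.instance Definition _ := GRing.isZmodule.Build (dualnum F)
  dual_addA dual_addC dual_add0 dual_addN.

Lemma dual_mulA : associative dual_mul.
Proof.
by move=> x y z; rewrite /dual_mul /= !mulrDr !mulrDl !mulrA !addrA.
Qed.
Lemma dual_mulC : commutative dual_mul.
Proof.
move=> [a b] [c d]; rewrite /dual_mul /= (mulrC c a) (mulrC c b) (mulrC d a).
by rewrite addrC.
Qed.
Lemma dual_mul1 : left_id dual_one dual_mul.
Proof. by move=> [a b]; rewrite /dual_mul /= !mul1r mul0r addr0. Qed.
Lemma dual_mulDl : left_distributive dual_mul dual_add.
Proof.
by move=> x y z; rewrite /dual_mul /dual_add /= !mulrDl addrACA.
Qed.
Lemma dual_one_neq0 : dual_one != dual_zero.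
Proof. by apply/eqP => -[] /eqP; rewrite oner_eq0. Qed.
HB.instance Definition _ := GRing.Zmodule_isComNzRing.Build (dualnum F)
  dual_mulA dual_mulC dual_mul1 dual_mulDl dual_one_neq0.

(* Division is defined exactly by dual numbers with nonzero real part; the
   value of the inverse elsewhere is the library's default. *)
Definition dual_unit : pred (dualnum F) := fun x => dual_re x != 0.
Definition dual_inv x :=
  if dual_re x != 0
  then Dual (dual_re x)^-1 (- dual_du x / dual_re x ^+ 2) else x.

Lemma dual_mulV : {in dual_unit, left_inverse 1 dual_inv *%R}.
Proof.
move=> [a b]; rewrite unfold_in /= => a0; rewrite /dual_inv /= a0.
apply: (congr2 (@Dual F)) => /=; first by rewrite mulVf.
by rewrite expr2 invfM mulrA mulfVK // mulNr mulrC subrr.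
Qed.
Lemma dual_unitP x y : y * x = 1 -> dual_unit x.
Proof.
move=> /(congr1 (@dual_re F)) /= yx1; apply/eqP => x0.
by move: yx1; rewrite x0 mulr0 => /eqP; rewrite eq_sym oner_eq0.
Qed.
Lemma dual_inv_out : {in [predC dual_unit], dual_inv =1 id}.
Proof.
by move=> x; rewrite inE unfold_in /= => /negbTE x0; rewrite /dual_inv x0.
Qed.
HB.instance Definition _ := GRing.ComNzRing_hasMulInverse.Build (dualnum F)
  dual_mulV dual_unitP dual_inv_out.

Definition shifted_factorial (a : dualnum F) (k : nat) : dualnum F :=
  \prod_(i < k) (a + i%:R).

Definition hyp2F1_term (a1 a2 b1 x : dualnum F) (k : nat) : dualnum F :=
  shifted_factorial a1 k * shifted_factorial a2 k * x ^+ k /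
  (shifted_factorial b1 k * k`!%:R).

End DualRing.

Section DualAnalysis.
Variable R : realType.

(* Euler's integral, meaningful for 0 < a. *)
Definition gamma_integral (a : R) : R :=
  \int[lebesgue_measure]_(t in `]0, +oo[) (expR (- t) * t `^ (a - 1)).

(* The least n with 0 < a + n%:R. *)
Definition gamma_shift (a : R) : nat :=
  if 0 < a then 0%N else (Num.truncn (- a)).+1.

(* The real gamma function, extended from the positive half-line by
   Gamma (a + 1) = a * Gamma a; its value at the poles 0, -1, -2, ... is
   meaningless. *)
Definition Gamma (a : R) : R :=
  gamma_integral (a + (gamma_shift a)%:R) /
  \prod_(i < gamma_shift a) (a + i%:R).

Definition dual_Gamma (x : dualnum R) : dualnum R :=
  Dual (Gamma (dual_re x)) (dual_du x * derive1 Gamma (dual_re x)).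

Definition dual_cvgn (u : nat -> dualnum R) : Prop :=
  cvgn (fun n => dual_re (u n)) /\ cvgn (fun n => dual_du (u n)).

Definition dual_limn (u : nat -> dualnum R) : dualnum R :=
  Dual (limn (fun n => dual_re (u n))) (limn (fun n => dual_du (u n))).

(* Only meaningful when [dual_cvgn] holds of the partial sums. *)
Definition hyp2F1 (a1 a2 b1 x : dualnum R) : dualnum R :=
  dual_limn (series (hyp2F1_term a1 a2 b1 x)).

End DualAnalysis.

(* Main.v *)
Require Import Defs.
From mathcomp Require Import all_boot all_order all_algebra.
From mathcomp Require Import all_classical all_reals all_analysis.
From mathcomp Require Import measurable_realfun ring lra.
Import Order.TTheory GRing.Theory Num.Theory.
Import numFieldNormedType.Exports.
Set Implicit Arguments.
Unset Strict Implicit.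
Unset Printing Implicit Defensive.
Local Open Scope classical_set_scope.
Local Open Scope ring_scope.

(** Gauss's own argument for the value at 1 works verbatim over the ring of dual
numbers, so the dual part never has to be obtained by differentiating a series
term by term. Write [S c] for the sum of the series with parameters [a], [b],
[c], and [W c] for Gamma(c - a) Gamma(c - b) / (Gamma(c) Gamma(c - a - b)). A
telescoping identity between the terms for [c] and for [c + 1] gives
c (c - a - b) S(c) = (c - a) (c - b) S(c + 1) ([gauss_sum_contiguous]); with the
functional equation of the dual gamma function it says that [S c * W c] does
not change when [c] becomes [c + 1]. As [m] grows, S(c + m) tends to 1
([cvg_gauss_sum1]) and so does W(c + m) ([cvg_gamma_ratio]); hence
[S c * W c = 1], which is the theorem.

Estimates on the dual series use the norms |x1| + d |x2| with [d > 0]. They are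
submultiplicative, and for small [d] the derivative part changes the ratio of
consecutive terms by an arbitrarily small multiple of 1/k, so that Raabe's test
applies to dual numbers directly ([gauss_term_ratio]) and no logarithms of [k]
appear.

The limit of W(c + m) requires Gamma to be differentiable and the behaviour of
Gamma and of its logarithmic derivative at infinity. Both follow, in the spirit
of Bohr and Mollerup, from two facts on Euler's integral: the functional
equation, by parts ([gamma_integralS]), and Wendel's inequality
Gamma(x + s) <= x^s Gamma(x) for 0 <= s <= 1 ([gamma_integral_wendel]). Shifting
the argument by [N] writes ln Gamma(x + h) - ln Gamma(x) as [h] times
ln(x + N) - sum_(k < N) 1/(x + k), up to an error at most a constant times
h^2 + |h|/(x + N), the constant depending on [x] alone; letting [N] tend to infinity gives the derivative
([lgamma_taylor]). *)

(** * Euler's integral: functional equation and Wendel's inequality *)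

Section EulerIntegral.
Variable R : realType.
Implicit Types (x s t : R) (n : nat).
Notation mu := (@lebesgue_measure R).

Definition euler_kernel x t : R := expR (- t) * t `^ (x - 1).
Definition euler_int x : \bar R :=
  (\int[mu]_(t in `]0%R, +oo[) (euler_kernel x t)%:E)%E.

Lemma euler_kernel_ge0 x t : 0 <= euler_kernel x t.
Proof. by rewrite mulr_ge0 ?expR_ge0 ?powR_ge0. Qed.

Lemma derive_expRN t : is_derive t 1 (fun u : R => - expR (- u)) (expR (- t)).
Proof.
apply: is_derive_eq; rewrite /GRing.scale /=; ring.
Qed.

Lemma continuous_expRN : continuous (fun u : R => expR (- u)).
Proof.
by move=> t; apply: continuous_comp; [exact: oppr_continuous|exact: continuous_expR].
Qed.

Lemma continuous_powR x t : 0 < t -> {for t, continuous (fun u : R => u `^ x)}.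
Proof.
move=> t0; apply: differentiable_continuous; apply/derivable1_diffP.
by have [] := is_derive1_powR x t0.
Qed.

Lemma continuous_euler_kernel x t : 0 < t -> {for t, continuous (euler_kernel x)}.
Proof.
by move=> t0; apply: continuousM; [exact: continuous_expRN|exact: continuous_powR].
Qed.

Lemma measurable_euler_kernel x :
  measurable_fun (`]0, +oo[%classic : set R) (euler_kernel x).
Proof.
apply: open_continuous_measurable_fun => // t.
by rewrite inE /= in_itv /= andbT => t0; exact: continuous_euler_kernel.
Qed.

Lemma within_continuous_pos a b (f : R -> R) : 0 < a ->
  (forall t, 0 < t -> {for t, continuous f}) -> {within `[a, b], continuous f}.
Proof.
move=> a0 cf; apply: continuous_in_subspaceT => t; rewrite inE /= in_itv /=.
by move=> /andP[/(lt_le_trans a0) t0 _]; exact: cf.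
Qed.

(** An exhaustion of the positive half-line by segments on which the kernel is
continuous; the endpoints use [n + 2] so that they are always distinct. *)
Definition trunc_itv n : set R := `[n.+2%:R^-1, n.+2%:R]%classic.

Lemma bigcup_trunc_itv : \bigcup_n trunc_itv n = `]0, +oo[%classic.
Proof.
apply/seteqP; split => t /=.
  move=> [n _]; rewrite /trunc_itv /= !in_itv /= andbT => /andP[+ _].
  by apply: lt_le_trans; rewrite invr_gt0.
rewrite in_itv /= andbT => t0.
exists (Num.truncn (t + t^-1)).+1 => //; rewrite /trunc_itv /= in_itv /=.
have ti0 : 0 < t^-1 by rewrite invr_gt0.
have h : t + t^-1 < (Num.truncn (t + t^-1)).+3%:R.
  by apply: (lt_le_trans (truncnS_gt _)); rewrite ler_nat ltnS !leqW.
apply/andP; split; last lra.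
rewrite -[leRHS]invrK lef_pV2 ?posrE ?invr_gt0//.
by rewrite (le_trans _ (ltW h))// lerDr ltW.
Qed.

Lemma nondecreasing_trunc_itv : nondecreasing_seq trunc_itv.
Proof.
move=> m n mn; rewrite subsetEset => t; rewrite /trunc_itv /= !in_itv /=.
move=> /andP[h1 h2]; apply/andP; split.
  by apply: le_trans h1; rewrite lef_pV2 ?posrE// ler_nat !ltnS.
by apply: le_trans h2 _; rewrite ler_nat !ltnS.
Qed.

Lemma sub_trunc_itv n : trunc_itv n `<=` `]0, +oo[%classic.
Proof. by rewrite -bigcup_trunc_itv; exact: bigcup_sup. Qed.

Lemma cvg_euler_int x :
  (\int[mu]_(t in trunc_itv n) (euler_kernel x t)%:E)%E @[n --> \oo]
    --> euler_int x.
Proof.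
rewrite /euler_int -bigcup_trunc_itv.
apply: ge0_nondecreasing_set_cvg_integral.
- exact: nondecreasing_trunc_itv.
- by move=> n; exact: measurable_itv.
- move=> n; apply: (measurable_funS _ (@sub_trunc_itv n)) => //.
  by apply/measurable_EFinP; exact: measurable_euler_kernel.
- by move=> n t _; rewrite lee_fin euler_kernel_ge0.
Qed.

Lemma trunc_by_parts x n : 0 < x ->
  (\int[mu]_(t in trunc_itv n) (euler_kernel (x + 1) t)%:E =
   (n.+2%:R^-1 `^ x * expR (- n.+2%:R^-1) - n.+2%:R `^ x * expR (- n.+2%:R))%:E
   + x%:E * \int[mu]_(t in trunc_itv n) (euler_kernel x t)%:E)%E.
Proof.
move=> x0.
have a0 : 0 < n.+2%:R^-1 :> R by rewrite invr_gt0.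
have ab : n.+2%:R^-1 < n.+2%:R :> R.
  apply: (@lt_trans _ _ 1); last by rewrite ltr1n.
  by rewrite invf_lt1 ?ltr1n.
have d1 t : 0 < t -> is_derive t 1 (fun u : R => u `^ x) (x * t `^ (x - 1)).
  exact: is_derive1_powR.
have d2 := derive_expRN.
have c1 t : 0 < t -> {for t, continuous (fun u : R => u `^ x)} by exact: continuous_powR.
have c2 : continuous (fun u : R => - expR (- u)).
  by move=> t; apply: cvgN; exact: continuous_expRN.
have mk : measurable_fun (trunc_itv n) (euler_kernel x).
  apply: (measurable_funS _ (@sub_trunc_itv n)) => //.
  exact: measurable_euler_kernel.
have := @integration_by_parts R (fun t => t `^ x) (fun t => - expR (- t))
  (fun t => x * t `^ (x - 1)) (fun t => expR (- t)) _ _ ab.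
rewrite -/(trunc_itv n).
have -> : (\int[mu]_(t in trunc_itv n) (t `^ x * expR (- t))%:E =
           \int[mu]_(t in trunc_itv n) (euler_kernel (x + 1) t)%:E)%E.
  by apply: eq_integral => t _; rewrite /euler_kernel addrK mulrC.
have -> : (\int[mu]_(t in trunc_itv n) (x * t `^ (x - 1) * - expR (- t))%:E =
           \int[mu]_(t in trunc_itv n) (- (x%:E * (euler_kernel x t)%:E)))%E.
  apply: eq_integral => t _; rewrite /euler_kernel -EFinM -EFinN; congr EFin; ring.
rewrite integral_ge0N; last first.
  by move=> t _; rewrite -EFinM lee_fin mulr_ge0 ?euler_kernel_ge0 ?ltW.
rewrite ge0_integralZl//; last 3 first.
- exact/measurable_EFinP.
- by move=> t _; rewrite lee_fin euler_kernel_ge0.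
- by rewrite lee_fin ltW.
rewrite oppeK => ->.
- by congr (_%:E + _)%E; ring.
- apply: within_continuous_pos => // t t0; apply: cvgM; [exact: cvg_cst|exact: continuous_powR].
- split.
  + move=> t; rewrite in_itv /= => /andP[/(lt_trans a0) t0 _].
    by have [] := d1 _ t0.
  + by apply: cvg_at_right_filter; exact: c1.
  + by apply: cvg_at_left_filter; apply: c1; rewrite (lt_trans a0).
- move=> t; rewrite in_itv /= => /andP[/(lt_trans a0) t0 _].
  by rewrite derive1E; have [_] := d1 _ t0.
- by apply: continuous_subspaceT; exact: continuous_expRN.
- split.
  + by move=> t _; have [] := d2 t.
  + by apply: cvg_at_right_filter; exact: c2.
  + by apply: cvg_at_left_filter; exact: c2.
- by move=> t _; rewrite derive1E; have [_] := d2 t.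
Unshelve. all: exact: measurable_itv.
Qed.

End EulerIntegral.

Section GammaIntegral.
Variable R : realType.
Implicit Types (x s t : R) (n : nat).
Notation mu := (@lebesgue_measure R).

(** Compare with the term of degree [k + 1] of the exponential series, where [k] is a
natural number above [x]. *)
Lemma cvg_powR_expRN x :
  (n.+2%:R `^ x * expR (- n.+2%:R)) @[n --> \oo] --> (0 : R).
Proof.
pose k := (Num.truncn `|x|).+1.
have xk : x <= k%:R by rewrite (le_trans (ler_norm _))// ltW// truncnS_gt.
apply: (@squeeze_cvgr _ _ _ _ (fun=> 0) (fun n => k.+1`!%:R * harmonic n)).
- near=> n; rewrite mulr_ge0 ?powR_ge0 ?expR_ge0 //=.
  have n0 : 0 < n.+2%:R :> R by [].
  rewrite expRN ler_pdivrMr ?expR_gt0//.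
  have h1 := @expR_ge1Dxn R n.+2%:R k (ltW n0).
  have h2 : n.+2%:R `^ x <= n.+2%:R ^+ k :> R.
    by rewrite -powR_mulrn// ler_powR// ler1n.
  apply: (le_trans h2).
  apply: (@le_trans _ _ (k.+1`!%:R * n.+1%:R^-1 * (n.+2%:R ^+ k.+1 / k.+1`!%:R))).
    have f0 : (k.+1`!%:R : R) != 0 by rewrite pnatr_eq0 -lt0n fact_gt0.
    rewrite [leRHS](_ : _ = n.+2%:R ^+ k * (n.+2%:R / n.+1%:R)); last first.
      by rewrite exprS; move: (n.+1%:R^-1) f0 => e f0; field.
    by rewrite ler_peMr ?exprn_ge0// ler_pdivlMr// mul1r ler_nat.
  rewrite ler_wpM2l ?mulr_ge0 ?invr_ge0//; lra.
- exact: cvg_cst.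
- by rewrite -(mulr0 (k.+1`!%:R)); apply: cvgM; [exact: cvg_cst|exact: cvg_harmonic].
Unshelve. all: by end_near. Qed.

Lemma cvg_inv_powR_expRN x : 0 < x ->
  (n.+2%:R^-1 `^ x * expR (- n.+2%:R^-1)) @[n --> \oo] --> (0 : R).
Proof.
move=> x0; rewrite -(mul0r (expR (- 0))).
have h0 : (n.+2%:R^-1 : R) @[n --> \oo] --> (0 : R).
  by have := @cvg_harmonic R; rewrite -(cvg_shiftS (@harmonic R)).
apply: cvgM.
  have : (a : R) `^ x @[a --> 0^'+] --> (0 : R) by exact: powR_cvg0.
  by move=> /cvg_at_rightP; apply; split => // n.
exact: (cvg_comp _ (fun u : R => expR (- u)) h0 (@continuous_expRN R 0)).
Qed.

Lemma euler_int_ge0 x : (0 <= euler_int x)%E.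
Proof. by apply: integral_ge0 => t _; rewrite lee_fin euler_kernel_ge0. Qed.

(** Integration by parts on each truncation, then monotone convergence. The
identity is between extended reals, so it also transfers finiteness from [x + 1]
to [x]. *)
Lemma euler_intS x : 0 < x -> euler_int (x + 1) = (x%:E * euler_int x)%E.
Proof.
move=> x0.
have := @cvg_euler_int R (x + 1).
under eq_cvg do rewrite trunc_by_parts//.
move=> h1.
have h2 : (n.+2%:R^-1 `^ x * expR (- n.+2%:R^-1) -
  n.+2%:R `^ x * expR (- n.+2%:R))%:E @[n --> \oo] --> (0 : R)%:E.
  apply: cvg_EFin; first exact: nearW.
  rewrite -[X in _ --> X](subr0 0); apply: cvgB.
    exact: cvg_inv_powR_expRN.
  exact: cvg_powR_expRN.
have h3 : (x%:E * \int[mu]_(t in @trunc_itv R n) (euler_kernel x t)%:E)%E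
  @[n --> \oo] --> (x%:E * euler_int x)%E.
  by apply: cvgeZl => //; exact: cvg_euler_int.
rewrite -(cvg_lim _ h1)//; apply/cvg_lim => //.
rewrite -[X in _ --> X]add0e.
by apply: cvgeD h2 h3.
Qed.

Lemma euler_int1_fin : (euler_int (1 : R) < +oo)%E.
Proof.
apply: (@le_lt_trans _ _ 1%E); last by rewrite ltry.
have e1 : (\int[mu]_(t in `[0%R, +oo[) (expR (- t : R))%:E = 0%:E - (- expR (- 0))%:E)%E.
  apply: (@ge0_continuous_FTC2y _ _ (fun t => - expR (- t))).
  - by move=> t _; exact: expR_ge0.
  - by apply: continuous_subspaceT; exact: continuous_expRN.
  - by rewrite -oppr0; apply: cvgN; exact: cvgr_expR.
  - by move=> t _; have [] := derive_expRN t.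
  - by apply: cvg_at_right_filter; apply: cvgN; exact: continuous_expRN.
  - by move=> t _; rewrite derive1E; have [_] := derive_expRN t.
have -> : (1 = \int[mu]_(t in `[0%R, +oo[) (expR (- t : R))%:E)%E.
  by rewrite e1 oppr0 expR0 sub0e EFinN oppeK.
rewrite (_ : euler_int 1 = \int[mu]_(t in `]0%R, +oo[) (expR (- t : R))%:E)%E; last first.
  by apply: eq_integral => t _; rewrite /euler_kernel subrr powRr0 mulr1.
apply: ge0_subset_integral => //=.
- apply/measurable_EFinP; apply: measurable_funTS.
  by apply: continuous_measurable_fun; exact: continuous_expRN.
- by apply: subset_itvr; rewrite bnd_simp.
Qed.

Lemma euler_intSn_fin n : (euler_int (n.+1%:R : R) < +oo)%E.
Proof.
elim: n => [|n IH]; first exact: euler_int1_fin.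
rewrite -[n.+2%:R]natr1 euler_intS// lte_mul_pinfty//.
Qed.

Lemma le_powR_1Dexp t (y : R) n : 0 < t -> 0 <= y -> y <= n%:R ->
  t `^ y <= 1 + t `^ n%:R.
Proof.
move=> t0 y0 yn; have [t1|t1] := leP 1 t.
  by rewrite (le_trans (ler_powR t1 yn))// lerDr.
rewrite (@le_trans _ _ 1)// ?lerDl ?powR_ge0//.
by rewrite -(powRr0 t) ger_powR// t0 ltW.
Qed.

(** Positive integers are reached from 1 by the functional equation; for [y >= 1]
the kernel is dominated by the sum of two kernels with integer parameters; the
interval from 0 to 1 is reached by the functional equation once more. *)
Lemma euler_int_fin x : 0 < x -> (euler_int x < +oo)%E.
Proof.
move=> x0.
suff h (y : R) : 1 <= y -> (euler_int y < +oo)%E.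
  have : (euler_int (x + 1) < +oo)%E by apply: h; rewrite lerDr ltW.
  rewrite euler_intS// !ltey.
  case: (euler_int x) (euler_int_ge0 x) => [r _ _ //|_|//].
  by rewrite gt0_muley ?lte_fin.
move=> y1; pose n := (Num.truncn y).+1.
have yn : y - 1 <= n%:R.
  by rewrite lerBlDr ltW// (lt_le_trans (truncnS_gt _))// lerDl.
have mk z : measurable_fun (`]0%R, +oo[%classic : set R) (EFin \o euler_kernel z).
  by apply/measurable_EFinP; exact: measurable_euler_kernel.
apply: (@le_lt_trans _ _ (euler_int 1 + euler_int (n%:R + 1))%E).
  rewrite /euler_int -ge0_integralD//=; last 4 first.
  - by move=> t _; rewrite lee_fin euler_kernel_ge0.
  - exact: mk.
  - by move=> t _; rewrite lee_fin euler_kernel_ge0.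
  - exact: mk.
  apply: ge0_le_integral => //=.
  - by move=> t _; rewrite lee_fin euler_kernel_ge0.
  - exact: mk.
  - by apply: emeasurable_funD; exact: mk.
  - move=> t; rewrite in_itv /= andbT => t0.
    rewrite -EFinD lee_fin /euler_kernel -mulrDr ler_wpM2l ?expR_ge0//.
    by rewrite subrr addrK powRr0; apply: le_powR_1Dexp => //; rewrite subr_ge0.
by rewrite lte_add_pinfty ?euler_int1_fin// natr1 euler_intSn_fin.
Qed.

Lemma euler_intE x : 0 < x -> euler_int x = (gamma_integral x)%:E.
Proof.
move=> x0; rewrite /gamma_integral /Rintegral fineK//.
rewrite ge0_fin_numE; first exact: euler_int_fin.
exact: euler_int_ge0.
Qed.

Lemma gamma_integralS x : 0 < x -> gamma_integral (x + 1) = x * gamma_integral x.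
Proof.
move=> x0; apply: EFin_inj; rewrite EFinM -!euler_intE ?addr_gt0//.
exact: euler_intS.
Qed.

(** The graph of the concave function t^s lies below its tangent at [x]. With
[u = t / x] this is the weighted inequality between the arithmetic and geometric
means of [u] and 1, obtained by adding two instances of [ln z <= z - 1]. *)
Lemma powR_le_tangent x s t : 0 < x -> 0 < t -> 0 <= s <= 1 ->
  t `^ s <= x `^ s * (1 - s) + x `^ s * (s / x) * t.
Proof.
move=> x0 t0 /andP[s0 s1].
pose u := t / x; have u0 : 0 < u by rewrite divr_gt0.
pose v := 1 - s + s * u.
have v0 : 0 < v by rewrite /v; nra.
have -> : x `^ s * (1 - s) + x `^ s * (s / x) * t = x `^ s * v.
  by rewrite /v /u; ring.
have -> : t `^ s = x `^ s * u `^ s.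
  by rewrite -powRM ?ltW// /u mulrC divfK ?gt_eqF.
rewrite ler_pM2l ?powR_gt0//.
rewrite -ler_ln ?posrE ?powR_gt0// ln_powR.
have l1 (z : R) : 0 < z -> ln z <= z - 1.
  move=> z0; have := @le_ln1Dx R (z - 1).
  by rewrite (_ : 1 + (z - 1) = z); [apply; lra|ring].
have h1 := l1 (u / v) (divr_gt0 u0 v0).
have h2 := l1 (v^-1); rewrite invr_gt0 in h2.
have {}h2 := h2 v0.
rewrite ln_div ?posrE// in h1; rewrite lnV ?posrE// in h2.
have e : s * (u / v - 1) + (1 - s) * (v^-1 - 1) = 0.
  by rewrite /v in v0 *; field; rewrite gt_eqF.
nra.
Qed.

(** On the segment from 1 to 2 the kernel is at least e^(-2) / 2, since
t^(x - 1) >= 1/t there. *)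
Lemma gamma_integral_gt0 x : 0 < x -> 0 < gamma_integral x.
Proof.
move=> x0; rewrite -lte_fin -euler_intE//.
have mk : measurable_fun (`]0%R, +oo[%classic : set R) (EFin \o euler_kernel x).
  by apply/measurable_EFinP; exact: measurable_euler_kernel.
have sub12 : (`[1, 2] : set R) `<=` `]0, +oo[.
  by move=> t /=; rewrite !in_itv /= andbT => /andP[h _]; lra.
apply: (@lt_le_trans _ _
    (\int[mu]_(t in `[1%R, 2%R]) (cst (expR (- 2) / 2)%:E t))%E).
  rewrite integral_cst//= lebesgue_measure_itv/= lte_fin ltr1n -EFinB -EFinM lte_fin.
  by rewrite mulr_gt0// ?divr_gt0 ?expR_gt0//; lra.
apply: (@le_trans _ _ (\int[mu]_(t in `[1%R, 2%R]) (euler_kernel x t)%:E)%E).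
  apply: ge0_le_integral => //=.
  - exact: (measurable_funS _ sub12 mk).
  - move=> t; rewrite in_itv /= => /andP[t1 t2]; rewrite lee_fin /euler_kernel.
    have t0 : 0 < t by lra.
    rewrite ler_pM ?expR_ge0 ?ler_expR ?lerN2//.
    apply: (@le_trans _ _ (t `^ (- 1))); last by rewrite ler_powR//; lra.
    by rewrite powR_inv1 ?lef_pV2 ?posrE//; exact: ltW.
apply: ge0_subset_integral => //=.
- by move=> t _; rewrite lee_fin euler_kernel_ge0.
Qed.

(** Integrate the tangent bound [powR_le_tangent] against the kernel of [x]: by the
functional equation the two terms on the right add up to x^s Gamma(x). *)
Lemma gamma_integral_wendel x s : 0 < x -> 0 <= s <= 1 ->
  gamma_integral (x + s) <= x `^ s * gamma_integral x.
Proof.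
move=> x0 s01.
have /andP[s0 s1] := s01.
have mk z : measurable_fun (`]0%R, +oo[%classic : set R) (EFin \o euler_kernel z).
  by apply/measurable_EFinP; exact: measurable_euler_kernel.
pose A := x `^ s * (1 - s); pose B := x `^ s * (s / x).
have A0 : 0 <= A by rewrite mulr_ge0 ?powR_ge0// subr_ge0.
have B0 : 0 <= B by rewrite mulr_ge0 ?powR_ge0// divr_ge0// ltW.
have -> : x `^ s * gamma_integral x =
    A * gamma_integral x + B * gamma_integral (x + 1).
  by rewrite gamma_integralS// /A /B; field; rewrite gt_eqF.
have xs0 : 0 < x + s by lra.
have x10 : 0 < x + 1 by lra.
rewrite -lee_fin EFinD !EFinM -!euler_intE//.
have k0 (c z t : R) : 0 <= c -> (0 <= c%:E * (euler_kernel z t)%:E)%E.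
  by move=> c0; rewrite -EFinM lee_fin mulr_ge0 ?euler_kernel_ge0.
have mck (c z : R) : measurable_fun (`]0%R, +oo[%classic : set R)
    (fun t => c%:E * (euler_kernel z t)%:E)%E.
  by apply: measurable_funeM; exact: mk.
rewrite /euler_int -!ge0_integralZl//=; do 1?[exact: mk];
  do 1?[by rewrite lee_fin]; do 1?[by move=> t _; rewrite lee_fin euler_kernel_ge0].
rewrite -ge0_integralD//=; do 1?[exact: mck]; do 1?[by move=> t _; exact: k0].
apply: ge0_le_integral => //=.
- by move=> t _; rewrite lee_fin euler_kernel_ge0.
- exact: mk.
- by apply: emeasurable_funD; exact: mck.
- move=> t; rewrite in_itv /= andbT => t0.
  rewrite -!EFinM -EFinD lee_fin /euler_kernel.
  have pD r : t `^ (x + r - 1) = t `^ (x - 1) * t `^ r.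
    by rewrite -powRD ?(gt_eqF t0) ?implybT// addrAC.
  rewrite !pD powRr1; last exact: ltW.
  have h := powR_le_tangent x0 t0 s01.
  rewrite -/A -/B in h *.
  rewrite [leRHS](_ : _ = expR (- t) * (t `^ (x - 1) * (A + B * t))); last ring.
  by rewrite ler_wpM2l ?expR_ge0// ler_wpM2l ?powR_ge0.
Unshelve. all: exact: measurable_itv.
Qed.

End GammaIntegral.

(** * Logarithm of the gamma function: derivative and asymptotics *)

Section LogGamma.
Variable R : realType.
Implicit Types (x y s t h : R) (n m k N : nat).

Lemma cvgy_addn x : x + n%:R @[n --> \oo] --> +oo.
Proof.
apply/cvgryPge => A; near=> n; rewrite -lerBlDl; near: n.
exact: nbhs_infty_ger.
Unshelve. all: by end_near. Qed.

Lemma cvg_inv_addn x : (x + n%:R)^-1 @[n --> \oo] --> 0.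
Proof.
have h := @cvgy_addn x.
by apply/(gtr0_cvgV0 _).2 => //; move/cvgryPgt : h; exact.
Qed.

(** Any function with these two properties of ln Gamma; they determine its
derivative, which is [digamma] below. *)
Variable lgamma : R -> R.
Hypothesis lgammaS : forall x, 0 < x -> lgamma (x + 1) = lgamma x + ln x.
Hypothesis lgamma_wendel : forall x s, 0 < x -> 0 <= s <= 1 ->
  lgamma (x + s) <= lgamma x + s * ln x.

Lemma lgammaDn x n : 0 < x ->
  lgamma (x + n%:R) = lgamma x + \sum_(k < n) ln (x + k%:R).
Proof.
move=> x0; elim: n => [|n IH]; first by rewrite big_ord0 !addr0.
by rewrite -natr1 addrA lgammaS ?ltr_wpDr// IH big_ord_recr /= addrA.
Qed.

(** Both bounds come from [ln z <= z - 1], at [z = (y + h) / y] and at its inverse. *)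
Lemma ln_near_linear y h : 0 < y -> - (y / 2) <= h ->
  h / y - 2 * (h ^+ 2 / y ^+ 2) <= ln (y + h) - ln y <= h / y.
Proof.
move=> y0 hy.
have l1 (z : R) : 0 < z -> ln z <= z - 1.
  move=> z0; have := @le_ln1Dx R (z - 1).
  by rewrite (_ : 1 + (z - 1) = z); [apply; lra|ring].
have yh0 : 0 < y + h by lra.
have yn0 : y != 0 by rewrite gt_eqF.
have yhn0 : y + h != 0 by rewrite gt_eqF.
have h1 := l1 ((y + h) / y) (divr_gt0 yh0 y0).
have h2 := l1 (y / (y + h)) (divr_gt0 y0 yh0).
rewrite !ln_div ?posrE// in h1 h2.
have e1 : (y + h) / y - 1 = h / y by field.
rewrite e1 in h1; rewrite h1 andbT.
suff : h / y - 2 * (h ^+ 2 / y ^+ 2) <= 1 - y / (y + h) by lra.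
have -> : 1 - y / (y + h) = h / y - h ^+ 2 / y ^+ 2 * (y / (y + h)).
  by field; rewrite ?yn0 ?yhn0.
rewrite lerD2l lerN2 mulrC ler_wpM2r ?divr_ge0 ?sqr_ge0// ler_pdivrMr//; lra.
Qed.

(** The lower bound is Wendel's inequality applied from [x + s] to [x + 1]. *)
Lemma lgammaD_bounds x s : 0 < x -> 0 <= s <= 1 ->
  s * ln x - s / x <= lgamma (x + s) - lgamma x <= s * ln x.
Proof.
move=> x0 /andP[s0 s1].
have xs0 : 0 < x + s by lra.
have h1 : lgamma (x + s) <= lgamma x + s * ln x by apply: lgamma_wendel; rewrite ?s0.
have h2 := @lgamma_wendel (x + s) (1 - s) xs0.
have e : x + s + (1 - s) = x + 1 by ring.
rewrite e lgammaS// in h2.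
have {}h2 : lgamma x + ln x <= lgamma (x + s) + (1 - s) * ln (x + s).
  by apply: h2; lra.
have /andP[_ h3] := @ln_near_linear x s x0 ltac:(lra).
have h4 : (1 - s) * ln (x + s) <= (1 - s) * (ln x + s / x).
  by apply: ler_wpM2l; lra.
have h5 : 0 <= s * (s / x) by rewrite mulr_ge0// divr_ge0// ltW.
apply/andP; split; lra.
Qed.

(** For negative [h], exchange the roles of [x] and [x + h]. *)
Lemma lgammaD_near x h : 0 < x -> `|h| <= 1 -> `|h| <= x / 2 ->
  `|lgamma (x + h) - lgamma x - h * ln x| <= 4 * (`|h| / x).
Proof.
move=> x0 h1 hx; have [h0|h0] := leP 0 h.
  rewrite ger0_norm// in h1 hx *.
  have := @lgammaD_bounds x h x0; rewrite h0 h1 => /(_ isT) /andP[a b].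
  have c : 0 <= h / x by rewrite divr_ge0// ltW.
  by rewrite ler_norml; apply/andP; split; lra.
rewrite ltr0_norm// in h1 hx *.
set y := x + h; have y0 : 0 < y by rewrite /y; lra.
have := @lgammaD_bounds y (- h) y0; rewrite h1 oppr_ge0 ltW// => /(_ isT).
have -> : y + - h = x by rewrite /y addrK.
move=> /andP[a b].
have /andP[_ c] := @ln_near_linear y (- h) y0 ltac:(lra).
rewrite (_ : y + - h = x) in c; last by rewrite /y addrK.
have d : ln y <= ln x by rewrite ler_ln ?posrE// /y; lra.
have e : - h / y <= 2 * (- h / x).
  have -> : 2 * (- h / x) = - h / (x / 2) by field; rewrite gt_eqF.
  apply: ler_wpM2l; first lra.
  by rewrite lef_pV2 ?posrE ?divr_gt0// /y; lra.
have f : - h * ln x <= - h * (ln y + - h / y) by rewrite ler_wpM2l//; lra.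
have g : - h * (- h / y) <= - h / y.
  by rewrite ger_pMl// divr_gt0//; lra.
have k : - h * ln y <= - h * ln x by rewrite ler_wpM2l//; lra.
by rewrite ler_norml; apply/andP; split; lra.
Qed.

(** What the functional equation gives for the derivative of ln Gamma at [x], once
its derivative at [x + N] is replaced by [ln (x + N)]. *)
Definition digamma_approx x N : R := ln (x + N%:R) - \sum_(k < N) (x + k%:R)^-1.

Definition sum_inv_sqr_bound x : R := (1 + x^-1) / x.

(** Each 1/y^2 is at most [1 + 1/x] times 1/y - 1/(y + 1), which telescopes. *)
Lemma sum_inv_sqr_le x N : 0 < x ->
  \sum_(k < N) (x + k%:R) ^- 2 <= sum_inv_sqr_bound x.
Proof.
move=> x0.
suff : \sum_(k < N) (x + k%:R) ^- 2 <= (1 + x^-1) * (x^-1 - (x + N%:R)^-1).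
  move=> /le_trans; apply; rewrite /sum_inv_sqr_bound ler_wpM2l//.
    by rewrite addr_ge0// invr_ge0 ltW.
  by rewrite gerBl invr_ge0 addr_ge0// ltW.
elim: N => [|N IH]; first by rewrite big_ord0 addr0 subrr mulr0.
rewrite big_ord_recr /=.
set y := x + N%:R in IH *.
have y0 : 0 < y by rewrite /y ltr_wpDr.
have xy : x <= y by rewrite /y lerDl.
have -> : x + N.+1%:R = y + 1 by rewrite /y -natr1 addrA.
have h : y ^- 2 <= (1 + x^-1) * (y^-1 - (y + 1)^-1).
  have -> : y^-1 - (y + 1)^-1 = y ^- 2 * (y / (y + 1)).
    by field; rewrite !gt_eqF//; lra.
  rewrite mulrCA; apply: ler_peMr; first by rewrite invr_ge0 exprn_ge0// ltW.
  have -> : (1 + x^-1) * (y / (y + 1)) = 1 + (y - x) / (x * (y + 1)).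
    by field; rewrite !gt_eqF//; lra.
  by rewrite lerDl divr_ge0 ?mulr_ge0//; lra.
lra.
Qed.

Lemma digamma_approxS x N : 0 < x ->
  - (2 * (x + N%:R) ^- 2) <= digamma_approx x N.+1 - digamma_approx x N <= 0.
Proof.
move=> x0; rewrite /digamma_approx big_ord_recr /= -[N.+1%:R]natr1 addrA.
set y := x + N%:R; have y0 : 0 < y by rewrite /y ltr_wpDr.
have /andP[] := @ln_near_linear y 1 y0 ltac:(lra).
rewrite expr1n !div1r => a b; apply/andP; split; lra.
Qed.

Lemma digamma_approx_ge x N : 0 < x ->
  ln x - 2 * sum_inv_sqr_bound x <= digamma_approx x N.
Proof.
move=> x0.
apply: (@le_trans _ _ (ln x - 2 * \sum_(k < N) (x + k%:R) ^- 2)).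
  by rewrite lerD2l lerN2 ler_wpM2l// sum_inv_sqr_le.
elim: N => [|N IH]; first by rewrite /digamma_approx !big_ord0 addr0 mulr0.
rewrite big_ord_recr /=; have /andP[+ _] := @digamma_approxS x N x0.
lra.
Qed.

Lemma nonincreasing_digamma_approx x : 0 < x -> nonincreasing_seq (digamma_approx x).
Proof.
move=> x0; apply/nonincreasing_seqP => N.
by have /andP[_] := @digamma_approxS x N x0; rewrite subr_le0.
Qed.

Lemma is_cvg_digamma_approx x : 0 < x -> cvgn (digamma_approx x).
Proof.
move=> x0; apply: nonincreasing_is_cvgn; first exact: nonincreasing_digamma_approx.
by exists (ln x - 2 * sum_inv_sqr_bound x) => _ [N _ <-]; exact: digamma_approx_ge.
Qed.

Definition digamma x : R := limn (digamma_approx x).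

Lemma digamma_bounds x : 0 < x ->
  ln x - 2 * sum_inv_sqr_bound x <= digamma x <= ln x.
Proof.
move=> x0; have c := is_cvg_digamma_approx x0; apply/andP; split.
  by apply: limr_ge => //; apply: nearW => N; exact: digamma_approx_ge.
apply: (@le_trans _ _ (digamma_approx x 0)).
  by apply: nonincreasing_cvgn_ge => //; exact: nonincreasing_digamma_approx.
by rewrite /digamma_approx big_ord0 addr0 subr0.
Qed.

(** Write the increment at [x] as the increment at [x + N] minus the increments of
the logarithms [ln (x + k)]: Wendel's inequality controls the first, the second
order expansion of [ln] the others. *)
Lemma lgamma_taylor_approx x h N : 0 < x -> `|h| <= 1 -> `|h| <= x / 2 ->
  `|lgamma (x + h) - lgamma x - h * digamma_approx x N| <=
  4 * (`|h| / (x + N%:R)) + 2 * (h ^+ 2 * sum_inv_sqr_bound x).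
Proof.
move=> x0 h1 hx.
have xh0 : 0 < x + h by have := lerNnormlW hx; lra.
have xN0 : 0 < x + N%:R by rewrite ltr_wpDr.
pose S := \sum_(k < N) (ln (x + h + k%:R) - ln (x + k%:R) - h * (x + k%:R)^-1).
have -> : lgamma (x + h) - lgamma x - h * digamma_approx x N =
  (lgamma (x + N%:R + h) - lgamma (x + N%:R) - h * ln (x + N%:R)) - S.
  rewrite (addrAC x) !lgammaDn// /S !sumrB /digamma_approx -mulr_sumr; ring.
apply: (le_trans (ler_normB _ _)); apply: lerD.
  by apply: lgammaD_near => //; rewrite (le_trans hx)// ler_pM2r// lerDl.
rewrite mulrCA mulrA.
apply: (@le_trans _ _ (\sum_(k < N) (h ^+ 2 * 2) * (x + k%:R) ^- 2)); last first.
  rewrite -mulr_sumr; apply: ler_wpM2l; last exact: sum_inv_sqr_le.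
  by apply: mulr_ge0 => //; exact: sqr_ge0.
apply: (le_trans (ler_norm_sum _ _ _)); apply: ler_sum => k _.
have xk0 : 0 < x + k%:R by rewrite ltr_wpDr.
have kk : 0 <= k%:R :> R by [].
have /andP[] := @ln_near_linear (x + k%:R) h xk0 ltac:(have := lerNnormlW hx; lra).
rewrite [x + h + _]addrAC => a b.
have c : 0 <= h ^+ 2 / (x + k%:R) ^+ 2 by rewrite divr_ge0 ?sqr_ge0.
by rewrite ler_norml; apply/andP; split; lra.
Qed.

Lemma lgamma_taylor x h : 0 < x -> `|h| <= 1 -> `|h| <= x / 2 ->
  `|lgamma (x + h) - lgamma x - h * digamma x| <=
  2 * (h ^+ 2 * sum_inv_sqr_bound x).
Proof.
move=> x0 h1 hx.
have c1 : `|lgamma (x + h) - lgamma x - h * digamma_approx x N| @[N --> \oo] -->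
    `|lgamma (x + h) - lgamma x - h * digamma x|.
  apply: cvg_norm; apply: cvgB; first exact: cvg_cst.
  by apply: cvgM; [exact: cvg_cst|exact: is_cvg_digamma_approx].
have c2 : (4 * (`|h| / (x + N%:R)) + 2 * (h ^+ 2 * sum_inv_sqr_bound x))
    @[N --> \oo] --> 2 * (h ^+ 2 * sum_inv_sqr_bound x).
  rewrite -[X in _ --> X]add0r; apply: cvgD; last exact: cvg_cst.
  rewrite -(mulr0 4); apply: cvgM; first exact: cvg_cst.
  rewrite -(mulr0 `|h|); apply: cvgM; first exact: cvg_cst.
  exact: cvg_inv_addn.
by apply: (ler_cvg_to c1 c2); apply: nearW => N; exact: lgamma_taylor_approx.
Qed.

Lemma cvg_ln_addn s : ln (s + m%:R) - ln (m%:R : R) @[m --> \oo] --> (0 : R).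
Proof.
rewrite -(ln1 R).
have h : 1 + s * (0 + m%:R)^-1 @[m --> \oo] --> (1 : R).
  rewrite -[X in _ --> X]addr0; apply: cvgD; first exact: cvg_cst.
  rewrite -[X in _ --> X](mulr0 s); apply: cvgM; first exact: cvg_cst.
  exact: cvg_inv_addn.
apply: cvg_trans (continuous_cvg _ (continuous_ln (@ltr01 R)) h).
apply: near_eq_cvg; near=> m.
have m0 : 0 < m%:R :> R by near: m; exact: nbhs_infty_gtr.
have sm0 : 0 < s + m%:R.
  by rewrite addrC -ltrBlDr sub0r; near: m; exact: nbhs_infty_gtr.
by rewrite /= -ln_div ?posrE// add0r; congr ln; field; rewrite gt_eqF.
Unshelve. all: by end_near. Qed.

(** By [lgammaD_near] the increment from [s + m] to [s + m + h] is [h * ln (s + m)] up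
to O(1/m), and ln (s + m) - ln m tends to 0. *)
Lemma lgamma_asymp_step s h : `|h| <= 1 ->
  lgamma (s + m%:R) - lgamma (m%:R : R) - s * ln m%:R @[m --> \oo] --> (0 : R) ->
  lgamma (s + h + m%:R) - lgamma (m%:R : R) - (s + h) * ln m%:R
    @[m --> \oo] --> (0 : R).
Proof.
move=> h1 Ps.
pose r m := lgamma (s + m%:R + h) - lgamma (s + m%:R) - h * ln (s + m%:R).
have r0 : r m @[m --> \oo] --> (0 : R).
  apply/norm_cvg0P.
  apply: (@squeeze_cvgr _ _ _ _ (fun=> 0) (fun m => 4 * (`|h| / (s + m%:R)))).
  - near=> m; rewrite normr_ge0 /=.
    have sm : 2 <= s + m%:R by rewrite -lerBlDl; near: m; exact: nbhs_infty_ger.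
    by apply: lgammaD_near => //; lra.
  - exact: cvg_cst.
  - rewrite -(mulr0 4); apply: cvgM; first exact: cvg_cst.
    rewrite -(mulr0 `|h|); apply: cvgM; first exact: cvg_cst.
    exact: cvg_inv_addn.
have e : (fun m => lgamma (s + h + m%:R) - lgamma m%:R - (s + h) * ln m%:R) =
    (fun m => r m + ((lgamma (s + m%:R) - lgamma m%:R - s * ln m%:R) +
                     h * (ln (s + m%:R) - ln m%:R))).
  by apply/funext => m; rewrite /r (addrAC s h); ring.
rewrite e -[X in _ --> X]addr0; apply: cvgD r0 _.
rewrite -[X in _ --> X]addr0; apply: cvgD Ps _.
by rewrite -[X in _ --> X](mulr0 h); apply: cvgM; [exact: cvg_cst|exact: cvg_ln_addn].
Unshelve. all: by end_near. Qed.

(** Reach [s] from 0 in finitely many steps of length at most 1. *)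
Lemma lgamma_asymp s :
  lgamma (s + m%:R) - lgamma (m%:R : R) - s * ln m%:R @[m --> \oo] --> (0 : R).
Proof.
pose n := (Num.truncn `|s|).+1.
have n0 : 0 < n%:R :> R by [].
pose h := s / n%:R.
have h1 : `|h| <= 1.
  rewrite normrM normfV ler_pdivrMr ?normr_gt0 ?gt_eqF// mul1r.
  by rewrite (@ger0_norm _ n%:R)// ltW// truncnS_gt.
have -> : s = n%:R * h by rewrite /h mulrC divfK ?gt_eqF.
elim: (n) => [|j IH].
  rewrite mul0r; under eq_cvg do rewrite add0r subrr mul0r subr0.
  exact: cvg_cst.
by rewrite -natr1 mulrDl mul1r; exact: lgamma_asymp_step.
Qed.

Lemma digamma_asymp s :
  digamma (s + m%:R) - ln (m%:R : R) @[m --> \oo] --> (0 : R).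
Proof.
have h : digamma (s + m%:R) - ln (s + m%:R) @[m --> \oo] --> (0 : R).
  have b0 : 2 * sum_inv_sqr_bound (s + m%:R) @[m --> \oo] --> (0 : R).
    rewrite -(mulr0 2); apply: cvgM; first exact: cvg_cst.
    rewrite -(mulr0 (1 + 0)); apply: cvgM; last exact: cvg_inv_addn.
    by apply: cvgD; [exact: cvg_cst|exact: cvg_inv_addn].
  apply: (@squeeze_cvgr _ _ _ _ (fun m => - (2 * sum_inv_sqr_bound (s + m%:R)))
    (fun=> 0)).
  - near=> m.
    have sm : 1 <= s + m%:R by rewrite -lerBlDl; near: m; exact: nbhs_infty_ger.
    have /andP[a b] := @digamma_bounds (s + m%:R) ltac:(lra).
    by apply/andP; split; lra.
  - by rewrite -oppr0; exact: cvgN.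
  - exact: cvg_cst.
have e : (fun m => digamma (s + m%:R) - ln (m%:R : R)) =
    (fun m => (digamma (s + m%:R) - ln (s + m%:R)) + (ln (s + m%:R) - ln m%:R)).
  by apply/funext => m; ring.
by rewrite e -[X in _ --> X]addr0; apply: cvgD h _; exact: cvg_ln_addn.
Unshelve. all: by end_near. Qed.

Lemma cvg_lgamma_slope x : 0 < x ->
  h^-1 *: (lgamma (h *: 1 + x) - lgamma x) @[h --> 0^'] --> digamma x.
Proof.
move=> x0; apply/cvgrPdist_le => e e0.
pose K := 2 * sum_inv_sqr_bound x + 1.
have K0 : 0 < K.
  by rewrite /K ltr_wpDl// mulr_ge0// divr_ge0 ?addr_ge0 ?invr_ge0 ?ltW.
near=> h.
have h0 : h != 0 by near: h; exact: nbhs_dnbhs_neq.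
have hn0 : 0 < `|h| by rewrite normr_gt0.
have h1 : `|h| <= 1 by near: h; exact: dnbhs0_le.
have hx : `|h| <= x / 2 by near: h; apply: dnbhs0_le; rewrite divr_gt0.
have he : `|h| <= e / K by near: h; apply: dnbhs0_le; rewrite divr_gt0.
have T := lgamma_taylor x0 h1 hx.
rewrite distrC /GRing.scale /= mulr1 (addrC h).
rewrite -(ler_pM2l hn0) -normrM mulrBr mulrA divff// mul1r.
apply: (le_trans T).
have -> : h ^+ 2 = `|h| * `|h| by rewrite -expr2 real_normK// num_real.
rewrite (_ : 2 * _ = `|h| * (`|h| * (K - 1))); last by rewrite /K; ring.
rewrite ler_pM2l// (@le_trans _ _ (`|h| * K))//.
  by rewrite ler_wpM2l// gerBl.
by rewrite -ler_pdivlMr.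
Unshelve. all: by end_near. Qed.

End LogGamma.

(** * The gamma function off its poles *)

Section GammaFunction.
Variable R : realType.
Implicit Types (x y s t h : R) (n m k N : nat).

Definition lnGamma x : R := ln (gamma_integral x).

Lemma lnGammaS x : 0 < x -> lnGamma (x + 1) = lnGamma x + ln x.
Proof.
move=> x0; rewrite /lnGamma gamma_integralS// lnM ?posrE ?gamma_integral_gt0//.
by rewrite addrC.
Qed.

Lemma lnGamma_wendel x s : 0 < x -> 0 <= s <= 1 ->
  lnGamma (x + s) <= lnGamma x + s * ln x.
Proof.
move=> x0 s01; have /andP[s0 _] := s01.
have xs0 : 0 < x + s by rewrite ltr_pwDl.
have -> : lnGamma x + s * ln x = ln (x `^ s * gamma_integral x).
  by rewrite lnM ?posrE ?powR_gt0 ?gamma_integral_gt0// ln_powR addrC.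
rewrite ler_ln ?posrE ?mulr_gt0 ?powR_gt0 ?gamma_integral_gt0//.
exact: gamma_integral_wendel.
Qed.

Lemma is_derive_lnGamma x : 0 < x -> is_derive x 1 lnGamma (digamma x).
Proof.
move=> x0; have h := cvg_lgamma_slope lnGammaS lnGamma_wendel x0.
by apply: DeriveDef; [exact: cvgP h|exact/cvg_lim].
Qed.

Lemma gamma_integralE x : 0 < x -> gamma_integral x = expR (lnGamma x).
Proof. by move=> x0; rewrite lnK// posrE gamma_integral_gt0. Qed.

Lemma Gamma_gt0E x : 0 < x -> Gamma x = expR (lnGamma x).
Proof.
by move=> x0; rewrite -gamma_integralE// /Gamma /gamma_shift x0 big_ord0 addr0 divr1.
Qed.

(** Holds at every real: at the poles both sides are 0, since the inverse of 0 is 0. *)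
Lemma GammaE x : Gamma x = Gamma (x + 1) / x.
Proof.
have [x0|x0] := ltP 0 x.
  have x10 : 0 < x + 1 by rewrite addr_gt0.
  apply: (etrans (Gamma_gt0E x0)); apply/esym.
  apply: (etrans (congr1 (fun z => z / x) (Gamma_gt0E x10))).
  rewrite lnGammaS// expRD lnK ?posrE// mulfK//.
  by rewrite gt_eqF.
have sE : gamma_shift x = (gamma_shift (x + 1)).+1.
  rewrite /gamma_shift ltNge x0 /=; congr S; case: ltP => x1.
    by apply/truncn0Pn; rewrite -ltNge ltrNl -subr_gt0 opprK.
  have -> : - x = 1 + - (x + 1) by rewrite opprD addrCA subrr addr0.
  by rewrite truncnD ?truncn1// nnegrE oppr_ge0.
have e1 : x + (gamma_shift (x + 1)).+1%:R = x + 1 + (gamma_shift (x + 1))%:R.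
  by rewrite -addrA nat1r.
have e2 : \prod_(i < (gamma_shift (x + 1)).+1) (x + i%:R) =
    x * \prod_(i < gamma_shift (x + 1)) (x + 1 + i%:R).
  rewrite big_ord_recl addr0; congr (_ * _); apply: eq_bigr => i _.
  by rewrite -addrA nat1r.
rewrite /Gamma sE e1 e2.
move: (gamma_integral _) (\prod_(_ < _) _) => A B.
by rewrite invfM mulrA mulrAC.
Qed.

Definition nonpole x := forall n, x <> - n%:R.

Lemma nonpoleS x : nonpole x -> nonpole (x + 1).
Proof.
move=> hx n e; apply: (hx n.+1); rewrite -natr1 opprD -e; ring.
Qed.

Lemma nonpole_neq0 x : nonpole x -> x != 0.
Proof. by move=> /(_ 0%N) /eqP; rewrite oppr0. Qed.

(** Descent from the positive half-line in unit steps. *)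
Lemma nonpole_ind (P : R -> Prop) : (forall x, 0 < x -> P x) ->
  (forall x, nonpole x -> P (x + 1) -> P x) -> forall x, nonpole x -> P x.
Proof.
move=> P0 PS x; have [n] : exists n, 0 < x + n%:R.
  by exists (Num.truncn (- x)).+1; rewrite addrC -ltrBlDr sub0r truncnS_gt.
elim: n x => [|n IH] x hx nx; first by apply: P0; rewrite addr0 in hx.
apply: PS => //; apply: IH; last exact: nonpoleS.
by rewrite -addrA nat1r.
Qed.

Lemma Gamma_neq0 x : nonpole x -> Gamma x != 0.
Proof.
move: x; apply: nonpole_ind => x hx; first by rewrite Gamma_gt0E// gt_eqF// expR_gt0.
by move=> h; rewrite GammaE mulf_neq0// invr_neq0// nonpole_neq0.
Qed.

Lemma is_derive_Gamma_gt0 x : 0 < x -> is_derive x 1 (@Gamma R) (Gamma x * digamma x).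
Proof.
move=> x0.
have d := is_derive1_comp (is_derive_expR (lnGamma x)) (is_derive_lnGamma x0).
have e : {near x, expR \o lnGamma =1 @Gamma R}.
  near=> y; rewrite /= Gamma_gt0E//; near: y; exact: lt_nbhsr.
rewrite Gamma_gt0E//; have [d1 d2] := d; apply: DeriveDef.
  exact: near_eq_derivable d1.
by rewrite -d2; symmetry; apply: near_eq_derive.
Unshelve. all: by end_near. Qed.

Lemma near_neq0 x : x != 0 -> \forall y \near x, y != 0.
Proof. by move=> x0; apply: open_nbhs_nbhs; split => //; exact: open_neq. Qed.

Lemma derivable_Gamma x : nonpole x -> derivable (@Gamma R) x 1.
Proof.
move: x; apply: nonpole_ind => x hx; first by have [] := is_derive_Gamma_gt0 hx.
move=> d; have x0 := nonpole_neq0 hx.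
have e : @Gamma R = (@Gamma R \o (fun y => y + 1)) * (fun y => y^-1).
  by apply/funext => y; exact: GammaE.
have d1 : is_derive x 1 (fun y : R => y + 1) 1 by apply: is_derive_eq; rewrite addr0.
have [d2 _] := @is_derive1_comp R (@Gamma R) (fun y => y + 1) x _ _ (derivableP d) d1.
have d3 := @derivableV R R (fun y => y) x 1 x0 (@derivable_id R R x 1).
by have := derivableM d2 d3; rewrite -e.
Qed.

(** Differentiate [y * Gamma y = Gamma (y + 1)], which holds near [x] as [x] is not
0. *)
Lemma derive1_GammaS x : nonpole x ->
  derive1 (@Gamma R) (x + 1) = Gamma x + x * derive1 (@Gamma R) x.
Proof.
move=> hx; have x0 := nonpole_neq0 hx.
have d1 : is_derive x 1 (fun y : R => y + 1) 1 by apply: is_derive_eq; rewrite addr0.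
have [_ D1] := @is_derive1_comp R (@Gamma R) (fun y => y + 1) x _ _
  (derivableP (derivable_Gamma (nonpoleS hx))) d1.
have [_ D2] := is_deriveM (is_derive_id x 1) (derivableP (derivable_Gamma hx)).
rewrite !derive1E; rewrite mulr1 in D1; rewrite -D1.
have e : \near x, (id * @Gamma R) x = (@Gamma R \o (fun y => y + 1)) x.
  near=> y; rewrite /= -[LHS]/(y * Gamma y) [in LHS]GammaE mulrC divfK//.
  by near: y; exact: near_neq0.
rewrite -(@near_eq_derive R R R _ _ x 1 e) D2 /GRing.scale /= mulr1 addrC.
by [].
Unshelve. all: by end_near. Qed.

End GammaFunction.

(** * The dual gamma function and convergence of dual sequences *)

Section DualGamma.
Variable R : realType.
Implicit Types (x y z : dualnum R) (n m k : nat).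

Lemma dual_eq x y : dual_re x = dual_re y -> dual_du x = dual_du y -> x = y.
Proof. by case: x y => [a b] [c d] /= -> ->. Qed.

Lemma dual_reD x y : dual_re (x + y) = dual_re x + dual_re y. Proof. by []. Qed.
Lemma dual_duD x y : dual_du (x + y) = dual_du x + dual_du y. Proof. by []. Qed.
Lemma dual_reN x : dual_re (- x) = - dual_re x. Proof. by []. Qed.
Lemma dual_duN x : dual_du (- x) = - dual_du x. Proof. by []. Qed.
Lemma dual_re1 : dual_re (1 : dualnum R) = 1. Proof. by []. Qed.
Lemma dual_du1 : dual_du (1 : dualnum R) = 0. Proof. by []. Qed.
Lemma dual_reM x y : dual_re (x * y) = dual_re x * dual_re y. Proof. by []. Qed.
Lemma dual_duM x y :
  dual_du (x * y) = dual_re x * dual_du y + dual_du x * dual_re y.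
Proof. by []. Qed.
Lemma dual_re_nat n : dual_re (n%:R : dualnum R) = n%:R.
Proof. by elim: n => // n IH; rewrite -!natr1 dual_reD IH. Qed.
Lemma dual_du_nat n : dual_du (n%:R : dualnum R) = 0.
Proof. by elim: n => // n IH; rewrite -natr1 dual_duD IH addr0. Qed.
Lemma dual_unitE x : (x \is a GRing.unit) = (dual_re x != 0).
Proof. by []. Qed.

Definition dualE := (dual_reD, dual_duD, dual_reN, dual_duN, dual_re1, dual_du1,
  dual_reM, dual_duM, dual_re_nat, dual_du_nat).

Lemma dual_GammaS x : nonpole (dual_re x) -> dual_Gamma (x + 1) = x * dual_Gamma x.
Proof.
move=> hx; have x0 := nonpole_neq0 hx; apply: dual_eq; rewrite /= ?addr0.
  by rewrite [in RHS]GammaE mulrC divfK.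
by rewrite derive1_GammaS//; ring.
Qed.

(** The extension of the exponential to dual numbers; it turns products and
quotients of dual gamma values into signed sums, where asymptotics can be added. *)
Definition dual_exp x : dualnum R :=
  Dual (expR (dual_re x)) (dual_du x * expR (dual_re x)).

Definition dual_lnGamma x : dualnum R :=
  Dual (lnGamma (dual_re x)) (dual_du x * digamma (dual_re x)).

Lemma dual_expD x y : dual_exp (x + y) = dual_exp x * dual_exp y.
Proof. by apply: dual_eq => /=; rewrite expRD//; ring. Qed.

Lemma dual_exp0 : dual_exp 0 = 1.
Proof. by apply: dual_eq => /=; rewrite ?expR0 ?mul0r. Qed.

Lemma dual_Gamma_exp x : 0 < dual_re x -> dual_Gamma x = dual_exp (dual_lnGamma x).
Proof.
move=> x0; apply: dual_eq => /=; first exact: Gamma_gt0E.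
have [_ D] := is_derive_Gamma_gt0 x0.
by rewrite derive1E D mulrC -mulrA (mulrC (digamma _)) [in LHS]mulrC Gamma_gt0E//; ring.
Qed.

Definition dual_cvg (u : nat -> dualnum R) (l : dualnum R) : Prop :=
  ((fun n => dual_re (u n)) @ \oo --> dual_re l) /\
  ((fun n => dual_du (u n)) @ \oo --> dual_du l).

Lemma dual_cvgD u v l1 l2 : dual_cvg u l1 -> dual_cvg v l2 ->
  dual_cvg (fun n => u n + v n) (l1 + l2).
Proof. by move=> [a b] [c d]; split; apply: cvgD. Qed.

Lemma dual_cvgN u l : dual_cvg u l -> dual_cvg (fun n => - u n) (- l).
Proof. by move=> [a b]; split; apply: cvgN. Qed.

Lemma dual_cvgM u v l1 l2 : dual_cvg u l1 -> dual_cvg v l2 ->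
  dual_cvg (fun n => u n * v n) (l1 * l2).
Proof.
by move=> [a b] [c d]; split; [exact: cvgM|apply: cvgD; exact: cvgM].
Qed.

Lemma dual_cvg_cst l : dual_cvg (fun=> l) l.
Proof. by split; exact: cvg_cst. Qed.

Lemma dual_cvg_lim u l : dual_cvg u l -> dual_cvgn u /\ dual_limn u = l.
Proof.
move=> [a b]; split; first by split; [exact: cvgP a|exact: cvgP b].
by apply: dual_eq => /=; exact/cvg_lim.
Qed.

Lemma dual_cvg_unique u l1 l2 : dual_cvg u l1 -> dual_cvg u l2 -> l1 = l2.
Proof. by move=> /dual_cvg_lim[_ <-] /dual_cvg_lim[_ <-]. Qed.

Lemma dual_cvg_exp u l : dual_cvg u l -> dual_cvg (dual_exp \o u) (dual_exp l).
Proof.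
move=> [a b].
have c : (fun n => expR (dual_re (u n))) @ \oo --> expR (dual_re l).
  exact: (continuous_cvg _ (@continuous_expR R _) a).
by split; [exact: c|exact: (cvgM b c)].
Qed.

(** A dual form of ln Gamma(x + m) = ln Gamma(m) + x ln m + o(1), covering both the
value and the derivative. *)
Lemma dual_lnGamma_asymp x :
  dual_cvg (fun m => dual_lnGamma (x + m%:R) -
    (Dual (lnGamma m%:R) 0 + x * Dual (ln m%:R) 0)) 0.
Proof.
split => /=.
  under eq_cvg => m do rewrite dual_re_nat opprD addrA.
  exact: (lgamma_asymp (@lnGammaS R) (@lnGamma_wendel R)).
rewrite -[X in _ --> X](mulr0 (dual_du x)).
under eq_cvg => m do
  rewrite dual_re_nat dual_du_nat addr0 mulr0 add0r add0r -mulrBr.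
by apply: cvgM; [exact: cvg_cst|exact: digamma_asymp].
Qed.

End DualGamma.

(** * Raabe's test and slowly decaying sequences *)

Section RealSequences.
Variable R : realType.
Implicit Types (u y w x : nat -> R).

Lemma is_cvg_series_telescope_le K u y : (forall k, 0 <= u k) -> (forall k, 0 <= y k) ->
  (forall k, (K <= k)%N -> u k <= y k - y k.+1) -> cvgn (series u).
Proof.
move=> u0 y0 uy.
have nd : nondecreasing_seq (series u) by exact: nondecreasing_series.
apply: nondecreasing_is_cvgn => //; exists (series u K + y K) => _ [n _ <-].
have h m : series u (m + K)%N <= series u K + (y K - y (m + K)%N).
  elim: m => [|m IH]; first by rewrite subrr addr0.
  rewrite addSn seriesSr; have := uy (m + K)%N (leq_addl _ _); lra.
apply: (le_trans (nd _ _ (leq_addr K n))); apply: (le_trans (h n)).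
by rewrite lerD2l gerBl.
Qed.

(** The limit exists by monotonicity; were it positive, the hypothesis would bound
the harmonic series by a telescoping one. *)
Lemma cvg_to_0_of_slow_decay K (kappa : R) x : 0 < kappa -> (forall k, 0 <= x k) ->
  (forall k, (K <= k)%N -> x k.+1 <= (1 - kappa / k.+1%:R) * x k) ->
  x @ \oo --> 0.
Proof.
move=> k0 x0 hx.
have hx' k : (K <= k)%N -> kappa * x k * k.+1%:R^-1 <= x k - x k.+1.
  by move=> /hx; move: (k.+1%:R^-1) => e; lra.
pose x' m := x (m + K)%N.
have ni : nonincreasing_seq x'.
  apply/nonincreasing_seqP => m; rewrite /x' -subr_ge0.
  apply: le_trans (hx' (m + K)%N (leq_addl _ _)).
  by rewrite divr_ge0// mulr_ge0// ltW.
have cx : cvgn x' by apply: nonincreasing_is_cvgn => //; exists 0 => _ [m _ <-]; exact: x0.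
have L0 : 0 <= limn x' by apply: limr_ge => //; apply: nearW => m; exact: x0.
have [Lz|] := eqVneq (limn x') 0.
  have c0 : x' @ \oo --> limn x' := cx.
  by rewrite Lz in c0; rewrite -(cvg_shiftn K).
move=> Ln; have Lp : 0 < limn x' by rewrite lt_neqAle eq_sym Ln.
exfalso; apply: (@dvg_harmonic R).
have c : cvgn (series ((kappa * limn x') *: (@harmonic R))).
  apply: (@is_cvg_series_telescope_le K _ x) => //.
    by move=> k; rewrite /GRing.scale /= divr_ge0// mulr_ge0// ltW.
  move=> k Kk; apply: le_trans (hx' _ Kk); rewrite /GRing.scale /= ler_wpM2r//.
  rewrite ler_wpM2l ?(ltW k0)//.
  have -> : x k = x' (k - K)%N by rewrite /x' subnK.
  exact: nonincreasing_cvgn_ge.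
have := @is_cvg_seriesZ R _ ((kappa * limn x')^-1) c.
by rewrite scalerA mulVf ?scale1r// mulf_neq0// gt_eqF.
Qed.

(** The hypothesis bounds [(sigma - 1) * w k] by k w(k) - (k + 1) w(k + 1), which
telescopes; it also makes k w(k) decay slowly to 0. *)
Lemma raabe K (sigma : R) w : 1 < sigma -> (forall k, 0 <= w k) ->
  (forall k, (K <= k)%N -> w k.+1 <= (1 - sigma / k.+1%:R) * w k) ->
  cvgn (series w) /\ (fun k => k%:R * w k) @ \oo --> 0.
Proof.
move=> s1 w0 hw.
have hw' k : (K <= k)%N -> (sigma - 1) * w k <= k%:R * w k - k.+1%:R * w k.+1.
  move=> Kk; have := hw k Kk.
  rewrite -(ler_pM2l (ltr0Sn R k)) mulrA mulrBr mulr1 (mulrC _ (_ / _)) divfK//.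
  by rewrite -[k.+1%:R in X in _ <= X -> _]natr1; lra.
have s0 : 0 < sigma - 1 by rewrite subr_gt0.
split.
  have c : cvgn (series ((sigma - 1) *: w)).
    apply: (@is_cvg_series_telescope_le K _ (fun k => k%:R * w k)) => //.
    - by move=> k; rewrite mulr_ge0// ltW.
    - by move=> k; rewrite mulr_ge0.
  have := @is_cvg_seriesZ R _ ((sigma - 1)^-1) c.
  by rewrite scalerA mulVf ?scale1r// gt_eqF.
apply: (@cvg_to_0_of_slow_decay K (sigma - 1)) => // [k|k Kk].
  by rewrite mulr_ge0.
rewrite mulrBl mul1r lerBrDr -lerBrDl; apply: le_trans (hw' _ Kk).
rewrite -mulrA ler_wpM2l ?(ltW s0)// mulrA ler_piMl//.
by rewrite mulrC ler_pdivrMr// mul1r ler_nat.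
Qed.

End RealSequences.

(** * Scaled norms on dual numbers *)

Section DualNorm.
Variables (R : realType) (d : R).
Hypothesis d0 : 0 <= d.
Implicit Types (x y : dualnum R).

(** The weight [d] makes the contribution of the dual part as small as needed while
keeping the norm submultiplicative. *)
Definition dual_norm x : R := `|dual_re x| + d * `|dual_du x|.

Lemma dual_norm_ge0 x : 0 <= dual_norm x.
Proof. by rewrite addr_ge0// mulr_ge0. Qed.

Lemma dual_normD x y : dual_norm (x + y) <= dual_norm x + dual_norm y.
Proof.
rewrite /dual_norm /= addrACA -mulrDr lerD ?ler_normD//.
by rewrite ler_wpM2l ?ler_normD.
Qed.

Lemma dual_normM x y : dual_norm (x * y) <= dual_norm x * dual_norm y.
Proof.
rewrite /dual_norm /= normrM.
have h := ler_normD (dual_re x * dual_du y) (dual_du x * dual_re y).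
rewrite !normrM in h; have {}h := ler_wpM2l d0 h.
have := mulr_ge0 (mulr_ge0 d0 d0) (mulr_ge0 (normr_ge0 (dual_du x)) (normr_ge0 (dual_du y))).
move: `|_| `|_| `|_| `|_| `|_| h => A B C D E h h2; nra.
Qed.

Lemma dual_norm_sum (I : Type) (r : seq I) (P : pred I) (F : I -> dualnum R) :
  dual_norm (\sum_(i <- r | P i) F i) <= \sum_(i <- r | P i) dual_norm (F i).
Proof.
elim/big_ind2: _ => [|x1 x2 y1 y2 h1 h2|//].
  by rewrite /dual_norm /= normr0 mulr0 addr0.
exact: le_trans (dual_normD _ _) (lerD h1 h2).
Qed.

Lemma dual_re_le_norm x : `|dual_re x| <= dual_norm x.
Proof. by rewrite lerDl mulr_ge0. Qed.

Lemma dual_du_le_norm x : d * `|dual_du x| <= dual_norm x.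
Proof. by rewrite lerDr. Qed.

End DualNorm.

(** * Algebra of the hypergeometric terms at 1 *)

Section HypergeometricTerms.
Variable R : realType.
Implicit Types (a b c : dualnum R) (k n : nat).

Definition gauss_term a b c k : dualnum R := hyp2F1_term a b c 1 k.

Lemma shifted_factorialS a k :
  shifted_factorial a k.+1 = shifted_factorial a k * (a + k%:R).
Proof. by rewrite /shifted_factorial big_ord_recr. Qed.

Lemma shifted_factorialSl a k :
  shifted_factorial a k.+1 = a * shifted_factorial (a + 1) k.
Proof.
rewrite /shifted_factorial big_ord_recl addr0; congr (_ * _).
by apply: eq_bigr => i _; rewrite -addrA nat1r.
Qed.

Lemma unit_addn c k : nonpole (dual_re c) -> c + k%:R \is a GRing.unit.
Proof.
move=> hc; rewrite dual_unitE !dualE; apply/eqP => e; apply: (hc k); lra.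
Qed.

Lemma unit_natr k : (k.+1%:R : dualnum R) \is a GRing.unit.
Proof. by rewrite dual_unitE dual_re_nat pnatr_eq0. Qed.

Lemma unit_shifted_factorial c k : nonpole (dual_re c) ->
  shifted_factorial c k \is a GRing.unit.
Proof.
move=> hc; elim: k => [|k IH]; first by rewrite /shifted_factorial big_ord0 unitr1.
by rewrite shifted_factorialS unitrM IH unit_addn.
Qed.

Lemma unit_fact k : (k`!%:R : dualnum R) \is a GRing.unit.
Proof. by rewrite dual_unitE dual_re_nat pnatr_eq0 -lt0n fact_gt0. Qed.

Lemma gauss_termM a b c k : nonpole (dual_re c) ->
  gauss_term a b c k * (shifted_factorial c k * k`!%:R) =
  shifted_factorial a k * shifted_factorial b k.
Proof.
move=> hc; rewrite /gauss_term /hyp2F1_term expr1n mulr1 divrK//.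
by rewrite unitrM unit_shifted_factorial// unit_fact.
Qed.

Lemma gauss_term0 a b c : gauss_term a b c 0 = 1.
Proof.
by rewrite /gauss_term /hyp2F1_term /shifted_factorial !big_ord0 expr0 !mulr1 divr1.
Qed.

Lemma gauss_termS a b c k : nonpole (dual_re c) ->
  gauss_term a b c k.+1 * ((c + k%:R) * k.+1%:R) =
  gauss_term a b c k * ((a + k%:R) * (b + k%:R)).
Proof.
move=> hc; have u : shifted_factorial c k * k`!%:R \is a GRing.unit.
  by rewrite unitrM unit_shifted_factorial// unit_fact.
apply: (mulIr u); rewrite mulrAC [RHS]mulrAC gauss_termM//.
have := gauss_termM a b k.+1 hc; rewrite !shifted_factorialS factS natrM => e.
rewrite [RHS]mulrACA -e -mulrA; congr (_ * _); ring.
Qed.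

Lemma gauss_term_shift a b c k : nonpole (dual_re c) ->
  gauss_term a b (c + 1) k * (c + k%:R) = gauss_term a b c k * c.
Proof.
move=> hc; have u : shifted_factorial c k * k`!%:R \is a GRing.unit.
  by rewrite unitrM unit_shifted_factorial// unit_fact.
apply: (mulIr u); rewrite mulrAC [RHS]mulrAC gauss_termM//.
have e := @gauss_termM a b (c + 1) k (nonpoleS hc).
rewrite mulrC.
have -> : (c + k%:R) * (gauss_term a b (c + 1) k * (shifted_factorial c k * k`!%:R)) =
  gauss_term a b (c + 1) k * (shifted_factorial c k * (c + k%:R) * k`!%:R) by ring.
rewrite -shifted_factorialS shifted_factorialSl -e; ring.
Qed.

(** After multiplication by [c + k] both sides become multiples of the same term, and
the coefficients agree as polynomials. *)
Lemma gauss_term_telescope a b c k : nonpole (dual_re c) ->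
  c * (c - a - b) * gauss_term a b c k -
  (c - a) * (c - b) * gauss_term a b (c + 1) k =
  c * (k%:R * gauss_term a b c k - k.+1%:R * gauss_term a b c k.+1).
Proof.
move=> hc; apply: (mulIr (unit_addn k hc)).
have e1 := gauss_termS a b k hc; have e2 := gauss_term_shift a b k hc.
move: (gauss_term a b c k) (gauss_term a b c k.+1) (gauss_term a b (c + 1) k) e1 e2.
move=> U U' V e1 e2.
have -> : (c * (c - a - b) * U - (c - a) * (c - b) * V) * (c + k%:R) =
  c * (c - a - b) * U * (c + k%:R) - (c - a) * (c - b) * (V * (c + k%:R)) by ring.
have -> : c * (k%:R * U - k.+1%:R * U') * (c + k%:R) =
  c * (k%:R * U * (c + k%:R) - U' * ((c + k%:R) * k.+1%:R)) by ring.
rewrite e1 e2; ring.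
Qed.

Lemma gauss_series_telescope a b c n : nonpole (dual_re c) ->
  c * (c - a - b) * series (gauss_term a b c) n -
  (c - a) * (c - b) * series (gauss_term a b (c + 1)) n =
  - (c * (n%:R * gauss_term a b c n)).
Proof.
move=> hc; elim: n => [|n IH].
  by rewrite !seriesEnat /= !big_geq// !mulr0 subrr mul0r mulr0 oppr0.
rewrite !seriesSr; have e := gauss_term_telescope a b n hc.
rewrite !(mulrDr _ (series _ _)).
rewrite opprD addrACA IH e; ring.
Qed.

End HypergeometricTerms.

(** * Convergence of the series and the contiguous relation *)

Section GaussSeriesBounds.
Variable R : realType.
Implicit Types (a b c x : dualnum R) (k n m : nat).

Lemma dual_reV x : dual_re x != 0 -> dual_re x^-1 = (dual_re x)^-1.
Proof. by move=> x0; rewrite /GRing.inv /= /dual_inv x0. Qed.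

Lemma dual_duV x : dual_re x != 0 -> dual_du x^-1 = - dual_du x / dual_re x ^+ 2.
Proof. by move=> x0; rewrite [in LHS]/GRing.inv /= /dual_inv x0. Qed.

Lemma dual_norm_ratio (d : R) x y : 0 <= d -> 0 <= dual_re x -> 0 < dual_re y ->
  dual_re x <= 2 * dual_re y ->
  dual_norm d (x / y) <=
  1 + (dual_re x - dual_re y + d * (`|dual_du x| + 2 * `|dual_du y|)) / dual_re y.
Proof.
case: x y => [x1 x2] [y1 y2] /= d0 x0 y0 xy.
have yn0 : y1 != 0 by rewrite gt_eqF.
rewrite /dual_norm dual_reM dual_duM dual_reV// dual_duV//=.
rewrite ger0_norm ?divr_ge0 ?(ltW y0)//.
have -> : 1 + (x1 - y1 + d * (`|x2| + 2 * `|y2|)) / y1 =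
  x1 / y1 + d * ((`|x2| + 2 * `|y2|) / y1) by field.
rewrite lerD2l ler_wpM2l//.
apply: (le_trans (ler_normD _ _)).
rewrite !normrM normfV !normrN normrX normfV (gtr0_norm y0) (ger0_norm x0).
rewrite addrC mulrDl lerD2l.
rewrite [leLHS](_ : _ = x1 / y1 * (`|y2| / y1)); last by field.
rewrite -[leRHS]mulrA ler_wpM2r ?divr_ge0 ?(ltW y0)//.
by rewrite ler_pdivrMr.
Qed.

(** The coefficient of [d / k] that the dual parts add to the norm of the ratio of
consecutive terms. *)
Definition du_weight a b c : R :=
  `|dual_du a| + (`|dual_du b| + 2 * `|dual_du c|).

(** After clearing denominators, the right-hand side minus the left-hand side is
linear in [k] with leading coefficient [- (p + q + sigma)]. *)
Lemma raabe_factor (p q c1 sigma : R) : p + q + sigma < 0 ->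
  \forall k \near \oo,
    (1 + p / k.+1%:R) * (1 + q / (c1 + k%:R)) <= 1 - sigma / k.+1%:R.
Proof.
move=> pq; near=> k.
have X0 : 0 < k.+1%:R :> R by [].
have Y0 : 0 < c1 + k%:R.
  by rewrite addrC -ltrBlDr sub0r; near: k; exact: nbhs_infty_gtr.
have big : ((p + sigma) * (c1 - 1) + p * q) / - (p + q + sigma) <= k.+1%:R.
  apply: (@le_trans _ _ k%:R); last by rewrite ler_nat.
  by near: k; exact: nbhs_infty_ger.
rewrite ler_pdivrMr ?oppr_gt0// in big.
rewrite -subr_ge0.
have -> : 1 - sigma / k.+1%:R - (1 + p / k.+1%:R) * (1 + q / (c1 + k%:R)) =
  (k.+1%:R * - (p + q + sigma) - ((p + sigma) * (c1 - 1) + p * q)) /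
  (k.+1%:R * (c1 + k%:R)).
  rewrite -natr1; rewrite -natr1 in X0; field.
  by rewrite !gt_eqF.
by rewrite divr_ge0 ?subr_ge0// mulr_ge0// ltW.
Unshelve. all: by end_near. Qed.

(** The ratio is (a + k)/(k + 1) times (b + k)/(c + k). For large [k] the norms of the
two factors are at most 1 + p/(k + 1) and 1 + q/(c + k), where [p] and [q] collect
the real parts and the weighted dual parts; the hypothesis is [p + q < -1]. *)
Lemma gauss_term_ratio (d : R) a b c : 0 <= d -> nonpole (dual_re c) ->
  dual_re a + dual_re b + d * du_weight a b c < dual_re c ->
  exists2 sigma : R, 1 < sigma & \forall k \near \oo,
    dual_norm d (gauss_term a b c k.+1) <=
    (1 - sigma / k.+1%:R) * dual_norm d (gauss_term a b c k).
Proof.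
move=> d0 hc h.
pose p := dual_re a - 1 + d * `|dual_du a|.
pose q := dual_re b - dual_re c + d * (`|dual_du b| + 2 * `|dual_du c|).
pose sigma := 1 + (- (p + q) - 1) / 2.
have pq : p + q < -1 by rewrite /p /q; rewrite /du_weight mulrDr in h; lra.
exists sigma; first by rewrite /sigma; lra.
have pqs : p + q + sigma < 0 by rewrite /sigma; lra.
have F := raabe_factor (dual_re c) pqs.
near=> k.
have Fk : (1 + p / k.+1%:R) * (1 + q / (dual_re c + k%:R)) <= 1 - sigma / k.+1%:R.
  by near: k.
have ak : 0 <= dual_re a + k%:R.
  by rewrite -lerBlDl sub0r; near: k; exact: nbhs_infty_ger.
have bk : 0 <= dual_re b + k%:R.
  by rewrite -lerBlDl sub0r; near: k; exact: nbhs_infty_ger.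
have ck : 0 < dual_re c + k%:R.
  by rewrite addrC -ltrBlDr sub0r; near: k; exact: nbhs_infty_gtr.
have bck : dual_re b - 2 * dual_re c <= k%:R by near: k; exact: nbhs_infty_ger.
have ak1 : dual_re a - 2 <= k%:R by near: k; exact: nbhs_infty_ger.
have uc := unit_addn k hc; have un := unit_natr R k.
have -> : gauss_term a b c k.+1 =
    gauss_term a b c k * ((a + k%:R) / k.+1%:R * ((b + k%:R) / (c + k%:R))).
  have u : (c + k%:R) * k.+1%:R \is a GRing.unit by rewrite unitrM uc.
  apply: (mulIr u); rewrite gauss_termS// -[RHS]mulrA; congr (_ * _).
  have := mulVr un; have := mulVr uc.
  move: (_^-1) (_^-1) => i1 i2 e1 e2.
  rewrite [RHS](_ : _ = (a + k%:R) * (b + k%:R) * (i2 * (c + k%:R)) * (i1 * k.+1%:R)).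
    by rewrite e1 e2 !mulr1.
  by ring.
apply: (le_trans (dual_normM d0 _ _)); rewrite mulrC.
apply: ler_wpM2r; first exact: dual_norm_ge0.
apply: (le_trans (dual_normM d0 _ _)); apply: le_trans Fk.
have h1 := @dual_norm_ratio d (a + k%:R) k.+1%:R d0.
have h2 := @dual_norm_ratio d (b + k%:R) (c + k%:R) d0.
rewrite !dualE normr0 mulr0 !addr0 in h1; rewrite !dualE !addr0 in h2.
apply: ler_pM; rewrite ?dual_norm_ge0//.
  rewrite (_ : p = dual_re a + k%:R - k.+1%:R + d * `|dual_du a|).
    by apply: h1 => //; rewrite -natr1; lra.
  by rewrite /p -natr1; ring.
rewrite (_ : q = dual_re b + k%:R - (dual_re c + k%:R) +
   d * (`|dual_du b| + 2 * `|dual_du c|)).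
  by apply: h2 => //; lra.
by rewrite /q; ring.
Unshelve. all: by end_near. Qed.

Lemma gauss_term_summable (d : R) a b c : 0 <= d -> nonpole (dual_re c) ->
  dual_re a + dual_re b + d * du_weight a b c < dual_re c ->
  cvgn (series (dual_norm d \o gauss_term a b c)) /\
  (fun k => k%:R * dual_norm d (gauss_term a b c k)) @ \oo --> 0.
Proof.
move=> d0 hc h; have [sigma s1 [K _ hK]] := gauss_term_ratio d0 hc h.
by apply: (@raabe R K sigma) => // k; exact: dual_norm_ge0.
Qed.

Lemma dual_re_sum (u : nat -> dualnum R) n :
  dual_re (series u n) = series (@dual_re R \o u) n.
Proof. by elim: n => [|n IH]; rewrite ?seriesSr ?dual_reD ?IH// !seriesEnat /= !big_geq. Qed.

Lemma dual_du_sum (u : nat -> dualnum R) n :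
  dual_du (series u n) = series (@dual_du R \o u) n.
Proof. by elim: n => [|n IH]; rewrite ?seriesSr ?dual_duD ?IH// !seriesEnat /= !big_geq. Qed.

Lemma dual_series_cvg (d : R) (u : nat -> dualnum R) : 0 < d ->
  cvgn (series (dual_norm d \o u)) -> dual_cvg (series u) (dual_limn (series u)).
Proof.
move=> d0 hu; split => /=.
  under eq_fun do rewrite dual_re_sum.
  apply: normed_cvg; apply: series_le_cvg hu => n //=; first exact: (dual_norm_ge0 (ltW d0)).
  exact: (dual_re_le_norm (ltW d0)).
under eq_fun do rewrite dual_du_sum.
apply: normed_cvg.
have h := @is_cvg_seriesZ R _ (d^-1) hu.
apply: series_le_cvg h => n //=.
  by rewrite mulr_ge0 ?invr_ge0 ?(ltW d0)//; exact: (dual_norm_ge0 (ltW d0)).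
by rewrite /GRing.scale /= ler_pdivlMl//; exact: dual_du_le_norm.
Qed.

Lemma dual_weight_ge0 a b c : 0 <= du_weight a b c.
Proof. by rewrite !addr_ge0// mulr_ge0. Qed.

Lemma exists_dual_scale a b c : dual_re a + dual_re b < dual_re c ->
  exists2 d : R, 0 < d & dual_re a + dual_re b + d * du_weight a b c < dual_re c.
Proof.
move=> h; have w0 := dual_weight_ge0 a b c.
pose w1 := 1 + du_weight a b c; have w10 : 0 < w1 by rewrite /w1; lra.
pose e := (dual_re c - (dual_re a + dual_re b)) / 2; have e0 : 0 < e by rewrite /e; lra.
exists (e / w1); first by rewrite divr_gt0.
have : e / w1 * du_weight a b c <= e.
  by rewrite mulrAC ler_pdivrMr// ler_wpM2l ?(ltW e0)// /w1; lra.
by rewrite /e; lra.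
Qed.

Definition gauss_sum a b c : dualnum R := dual_limn (series (gauss_term a b c)).

Lemma gauss_series_cvg a b c : nonpole (dual_re c) -> dual_re a + dual_re b < dual_re c ->
  dual_cvg (series (gauss_term a b c)) (gauss_sum a b c).
Proof.
move=> hc h; have [d d0 hd] := exists_dual_scale h.
by have [hs _] := gauss_term_summable (ltW d0) hc hd; exact: dual_series_cvg d0 hs.
Qed.

Lemma dual_cvg0_norm (d : R) (v : nat -> dualnum R) : 0 < d ->
  (fun n => dual_norm d (v n)) @ \oo --> 0 -> dual_cvg v 0.
Proof.
move=> d0 hv; split.
  apply/norm_cvg0P; apply: (@squeeze_cvgr _ _ _ _ (fun=> 0) (fun n => dual_norm d (v n))).
  - by apply: nearW => n; rewrite normr_ge0; exact: (dual_re_le_norm (ltW d0)).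
  - exact: cvg_cst.
  - exact: hv.
apply/norm_cvg0P.
apply: (@squeeze_cvgr _ _ _ _ (fun=> 0) (fun n => d^-1 * dual_norm d (v n))).
- by apply: nearW => n; rewrite normr_ge0 ler_pdivlMl//; exact: dual_du_le_norm.
- exact: cvg_cst.
- by rewrite -(mulr0 d^-1); apply: cvgM => //; exact: cvg_cst.
Qed.

Lemma dual_norm_natM (d : R) n x : dual_norm d (n%:R * x) = n%:R * dual_norm d x.
Proof.
rewrite /dual_norm !dualE mul0r addr0 !normrM normr_nat; ring.
Qed.

Lemma cvg_n_gauss_term a b c : nonpole (dual_re c) -> dual_re a + dual_re b < dual_re c ->
  dual_cvg (fun n => n%:R * gauss_term a b c n) 0.
Proof.
move=> hc h; have [d d0 hd] := exists_dual_scale h.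
have [_ hs] := gauss_term_summable (ltW d0) hc hd.
apply: (dual_cvg0_norm d0).
by under eq_cvg do rewrite dual_norm_natM.
Qed.

(** Limit of [gauss_series_telescope], whose right-hand side tends to 0. *)
Lemma gauss_sum_contiguous a b c : nonpole (dual_re c) ->
  dual_re a + dual_re b < dual_re c ->
  c * (c - a - b) * gauss_sum a b c = (c - a) * (c - b) * gauss_sum a b (c + 1).
Proof.
move=> hc h; have h' : dual_re a + dual_re b < dual_re (c + 1) by rewrite !dualE; lra.
have c1 := gauss_series_cvg hc h.
have c2 := gauss_series_cvg (nonpoleS hc : nonpole (dual_re (c + 1))) h'.
have c3 := dual_cvgN (dual_cvgM (dual_cvg_cst c) (cvg_n_gauss_term hc h)).
have c4 := dual_cvgD (dual_cvgM (dual_cvg_cst (c * (c - a - b))) c1)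
  (dual_cvgN (dual_cvgM (dual_cvg_cst ((c - a) * (c - b))) c2)).
apply/eqP; rewrite -subr_eq0; apply/eqP.
rewrite mulr0 oppr0 in c3; apply: dual_cvg_unique c4 _.
rewrite (_ : (fun n => _) = (fun n => - (c * (n%:R * gauss_term a b c n)))) //.
by apply/funext => n; exact: gauss_series_telescope.
Qed.

End GaussSeriesBounds.

(** * Limits at infinity and Gauss's theorem *)

Section GaussTheorem.
Variable R : realType.
Implicit Types (a b c x : dualnum R) (k n m : nat).

Lemma nonpole_gt0 (x : R) : 0 < x -> nonpole x.
Proof. by move=> x0 n e; have : 0 <= n%:R :> R by []; rewrite e oppr_gt0 in x0; lra. Qed.

(** The terms for [c + 1] are those for [c] times [c / (c + k)]. Writing [c1] for the
real part of [c], the norm of that factor is at most [1 - k / (2 * (c1 + k))],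
which is largest at [k = 1]. *)
Lemma gauss_term_shift_norm (d : R) a b c k : 0 <= d -> 0 < dual_re c ->
  d * `|dual_du c| <= dual_re c / 2 -> (0 < k)%N ->
  dual_norm d (gauss_term a b (c + 1) k) <=
  (1 - (2 * (dual_re c + 1))^-1) * dual_norm d (gauss_term a b c k).
Proof.
move=> d0 c0 dc k0; have hc := nonpole_gt0 c0.
have uc := unit_addn k hc.
have -> : gauss_term a b (c + 1) k = gauss_term a b c k * (c / (c + k%:R)).
  by apply: (mulIr uc); rewrite gauss_term_shift// mulrA divrK.
apply: (le_trans (dual_normM d0 _ _)); rewrite mulrC.
apply: ler_wpM2r; first exact: dual_norm_ge0.
have k1 : 1 <= k%:R :> R by rewrite ler1n.
have ck0 : 0 < dual_re c + k%:R by lra.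
have r0 : dual_re (c + k%:R) != 0 by rewrite !dualE gt_eqF.
rewrite /dual_norm dual_reM dual_duM dual_reV// dual_duV//= dual_re_nat dual_du_nat addr0.
move: (dual_re c) (dual_du c) (k%:R) c0 dc k1 ck0 => c1 c2 K c0 dc k1 ck0 {r0 uc hc}.
rewrite ger0_norm ?divr_ge0 ?(ltW c0) ?(ltW ck0)//.
have -> : c1 * (- c2 / (c1 + K) ^+ 2) + c2 / (c1 + K) = c2 * (K / (c1 + K) ^+ 2).
  by field; rewrite gt_eqF.
have K0 : 0 <= K by lra.
rewrite normrM (ger0_norm (divr_ge0 K0 (sqr_ge0 _))) (mulrA d).
apply: (@le_trans _ _ (c1 / (c1 + K) + (c1 + K) / 2 * (K / (c1 + K) ^+ 2))).
  by rewrite lerD2l ler_wpM2r ?divr_ge0 ?sqr_ge0//; lra.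
have -> : c1 / (c1 + K) + (c1 + K) / 2 * (K / (c1 + K) ^+ 2) = 1 - K / (2 * (c1 + K)).
  by field; rewrite gt_eqF.
rewrite lerD2l lerN2 ler_pdivlMr ?mulr_gt0// mulrC ler_pdivrMr; nra.
Qed.

Definition decay (kappa : R) m : R := \prod_(j < m) (1 - kappa / j.+1%:R).

Lemma decay_ge0 kappa m : 0 <= kappa <= 1 -> 0 <= decay kappa m.
Proof.
move=> /andP[k0 k1]; apply: prodr_ge0 => j _.
by rewrite subr_ge0 ler_pdivrMr// mul1r (le_trans k1)// ler1n.
Qed.

Lemma cvg_decay kappa : 0 < kappa <= 1 -> decay kappa @ \oo --> 0.
Proof.
move=> /andP[k0 k1]; apply: (@cvg_to_0_of_slow_decay R 0 kappa) => //.
  by move=> m; rewrite decay_ge0// (ltW k0).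
by move=> m _; rewrite /decay big_ord_recr /= mulrC.
Qed.

(** The factor lost from [c + m] to [c + m + 1] is 1 - 1/(2 (c1 + m + 1)), with [c1] the
real part of [c], and c1 + m + 1 <= (c1 + 1) (m + 1). *)
Lemma gauss_term_decay (d : R) a b c k m : 0 <= d -> 0 < dual_re c ->
  d * `|dual_du c| <= dual_re c / 2 -> (0 < k)%N ->
  dual_norm d (gauss_term a b (c + m%:R) k) <=
  decay (2 * (dual_re c + 1))^-1 m * dual_norm d (gauss_term a b c k).
Proof.
move=> d0 c0 dc k0; elim: m => [|m IH].
  by rewrite addr0 /decay big_ord0 mul1r.
have m0 : 0 <= m%:R :> R by [].
have := @gauss_term_shift_norm d a b (c + m%:R) k d0.
rewrite -addrA natr1 !dualE addr0 => h.
apply: le_trans (h _ _ k0) _; [lra|lra|].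
rewrite /decay big_ord_recr /= mulrAC [leLHS]mulrC.
apply: ler_pM; rewrite ?dual_norm_ge0//.
  by rewrite subr_ge0 invf_le1; lra.
rewrite lerD2l lerN2 -invfM lef_pV2 ?posrE ?mulr_gt0 -?natr1; try lra.
by nra.
Qed.

Lemma dual_norm_cvg (d : R) (u : nat -> dualnum R) l :
  dual_cvg u l -> dual_norm d (u n) @[n --> \oo] --> dual_norm d l.
Proof.
move=> [h1 h2]; apply: cvgD; first exact: cvg_norm.
by apply: cvgM; [exact: cvg_cst|exact: cvg_norm].
Qed.

(** Only the term of index 0, equal to 1, survives: the norms of all the others decay
with [m] at a common rate, and their sum at [m = 0] is finite. *)
Lemma cvg_gauss_sum1 (d : R) a b c : 0 < d -> 0 < dual_re c ->
  d * `|dual_du c| <= dual_re c / 2 ->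
  dual_re a + dual_re b + d * du_weight a b c < dual_re c ->
  dual_cvg (fun m => gauss_sum a b (c + m%:R)) 1.
Proof.
move=> d0 c0 dc hd; have hc := nonpole_gt0 c0.
have [hs _] := gauss_term_summable (ltW d0) hc hd.
set kappa := (2 * (dual_re c + 1))^-1.
have k01 : 0 < kappa <= 1 by rewrite invr_gt0 invf_le1; lra.
pose B := limn (series (dual_norm d \o gauss_term a b c)).
have nd : nondecreasing_seq (series (dual_norm d \o gauss_term a b c)).
  by apply: nondecreasing_series => k _ _; exact: (dual_norm_ge0 (ltW d0)).
have hB n : series (dual_norm d \o gauss_term a b c) n <= B.
  exact: nondecreasing_cvgn_le.
have w0 := dual_weight_ge0 a b c.
have dw0 : 0 <= d * du_weight a b c by rewrite mulr_ge0// ltW.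
have bound m : dual_norm d (gauss_sum a b (c + m%:R) - 1) <= decay kappa m * B.
  have m0 : 0 <= m%:R :> R by [].
  have cm0 : 0 < dual_re (c + m%:R) by rewrite !dualE; lra.
  have abm : dual_re a + dual_re b < dual_re (c + m%:R) by rewrite !dualE; lra.
  have cv := gauss_series_cvg (nonpole_gt0 cm0) abm.
  have cv1 := @dual_norm_cvg d _ _ (dual_cvgD cv (dual_cvg_cst (- 1))).
  apply: (ler_cvg_to cv1 (cvg_cst (decay kappa m * B))).
  near=> n.
  have n0 : (0 < n)%N by near: n; exists 1%N.
  rewrite -(prednK n0) seriesEnat /= big_nat_recl// gauss_term0 addrAC subrr add0r.
  apply: (le_trans (dual_norm_sum (ltW d0) _ _ _)).
  apply: (@le_trans _ _ (\sum_(0 <= k < n.-1)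
      decay kappa m * dual_norm d (gauss_term a b c k.+1))).
    by apply: ler_sum => k _; exact: gauss_term_decay (ltW d0) c0 dc _.
  rewrite -mulr_sumr ler_wpM2l ?decay_ge0//; first by case/andP: k01 => /ltW -> ->.
  apply: le_trans (hB n); rewrite -[in leRHS](prednK n0) seriesEnat /= big_nat_recl//.
  by rewrite lerDr; exact: (dual_norm_ge0 (ltW d0)).
have z : dual_cvg (fun m => gauss_sum a b (c + m%:R) - 1) 0.
  apply: (dual_cvg0_norm d0).
  apply: (@squeeze_cvgr _ _ _ _ (fun=> 0) (fun m => decay kappa m * B)).
  - by apply: nearW => m; rewrite (dual_norm_ge0 (ltW d0)) bound.
  - exact: cvg_cst.
  - by rewrite -(mul0r B); apply: cvgM; [exact: cvg_decay|exact: cvg_cst].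
have := dual_cvgD z (dual_cvg_cst 1); rewrite add0r.
by under eq_fun do rewrite subrK.
Unshelve. all: by end_near. Qed.

(** The inverse of the right-hand side of Gauss's formula. *)
Definition gamma_ratio a b c : dualnum R :=
  dual_Gamma (c - a) * dual_Gamma (c - b) / (dual_Gamma c * dual_Gamma (c - a - b)).

Lemma unit_dual_Gamma x : nonpole (dual_re x) -> dual_Gamma x \is a GRing.unit.
Proof. by move=> hx; rewrite dual_unitE; exact: Gamma_neq0. Qed.

Lemma gamma_ratioM a b c : nonpole (dual_re c) -> nonpole (dual_re (c - a - b)) ->
  gamma_ratio a b c * (dual_Gamma c * dual_Gamma (c - a - b)) =
  dual_Gamma (c - a) * dual_Gamma (c - b).
Proof.
by move=> h1 h4; rewrite /gamma_ratio divrK// unitrM !unit_dual_Gamma.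
Qed.

Lemma gamma_ratioS a b c : nonpole (dual_re c) -> nonpole (dual_re (c - a)) ->
  nonpole (dual_re (c - b)) -> nonpole (dual_re (c - a - b)) ->
  gamma_ratio a b (c + 1) * (c * (c - a - b)) =
  gamma_ratio a b c * ((c - a) * (c - b)).
Proof.
move=> h1 h2 h3 h4.
have w : dual_Gamma c * dual_Gamma (c - a - b) \is a GRing.unit.
  by rewrite unitrM !unit_dual_Gamma.
have ea : c + 1 - a = c - a + 1 by ring.
have eb : c + 1 - b = c - b + 1 by ring.
have eab : c + 1 - a - b = c - a - b + 1 by ring.
have e := @gamma_ratioM a b (c + 1) (nonpoleS h1).
rewrite eab ea eb in e; have {}e := e (nonpoleS h4).
rewrite !dual_GammaS// in e.
apply: (mulIr w); rewrite [RHS]mulrAC gamma_ratioM//.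
have -> : dual_Gamma (c - a) * dual_Gamma (c - b) * ((c - a) * (c - b)) =
  (c - a) * dual_Gamma (c - a) * ((c - b) * dual_Gamma (c - b)) by ring.
by rewrite -e; ring.
Qed.

Lemma gauss_sum_gamma_ratioS a b c : nonpole (dual_re c) ->
  nonpole (dual_re (c - a)) -> nonpole (dual_re (c - b)) ->
  dual_re a + dual_re b < dual_re c ->
  gauss_sum a b (c + 1) * gamma_ratio a b (c + 1) =
  gauss_sum a b c * gamma_ratio a b c.
Proof.
move=> h1 h2 h3 h.
have h4 : nonpole (dual_re (c - a - b)) by apply: nonpole_gt0; rewrite !dualE; lra.
have u : c * (c - a - b) \is a GRing.unit by rewrite unitrM !dual_unitE !nonpole_neq0.
apply: (mulIr u); rewrite -mulrA gamma_ratioS//.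
have e := gauss_sum_contiguous h1 h.
have -> : gauss_sum a b (c + 1) * (gamma_ratio a b c * ((c - a) * (c - b))) =
  gamma_ratio a b c * ((c - a) * (c - b) * gauss_sum a b (c + 1)) by ring.
by rewrite -e; ring.
Qed.

Lemma gauss_sum_gamma_ratioDn a b c m : nonpole (dual_re c) ->
  nonpole (dual_re (c - a)) -> nonpole (dual_re (c - b)) ->
  dual_re a + dual_re b < dual_re c ->
  gauss_sum a b (c + m%:R) * gamma_ratio a b (c + m%:R) =
  gauss_sum a b c * gamma_ratio a b c.
Proof.
elim: m c => [|m IH] c h1 h2 h3 h; first by rewrite addr0.
rewrite -nat1r addrA IH.
- exact: gauss_sum_gamma_ratioS.
- exact: nonpoleS.
- by rewrite addrAC; exact: nonpoleS.
- by rewrite addrAC; exact: nonpoleS.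
- by rewrite !dualE; lra.
Qed.

Lemma gamma_ratio_exp a b c : 0 < dual_re c -> 0 < dual_re (c - a) ->
  0 < dual_re (c - b) -> 0 < dual_re (c - a - b) ->
  gamma_ratio a b c = dual_exp (dual_lnGamma (c - a) + dual_lnGamma (c - b) -
    dual_lnGamma c - dual_lnGamma (c - a - b)).
Proof.
move=> h1 h2 h3 h4.
have w : dual_Gamma c * dual_Gamma (c - a - b) \is a GRing.unit.
  by rewrite unitrM !unit_dual_Gamma//; exact: nonpole_gt0.
apply: (mulIr w); rewrite gamma_ratioM; try exact: nonpole_gt0.
rewrite (dual_Gamma_exp h1) (dual_Gamma_exp h2) (dual_Gamma_exp h3) (dual_Gamma_exp h4).
move: (dual_lnGamma _) (dual_lnGamma _) (dual_lnGamma _) (dual_lnGamma _) => u v w' z.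
by rewrite -!dual_expD; congr dual_exp; ring.
Qed.

(** The exponent is a signed sum of four remainders in [dual_lnGamma_asymp]; the main
terms cancel because (c - a) + (c - b) = c + (c - a - b). *)
Lemma cvg_gamma_ratio a b c : 0 < dual_re c -> 0 < dual_re (c - a) ->
  0 < dual_re (c - b) -> 0 < dual_re (c - a - b) ->
  dual_cvg (fun m => gamma_ratio a b (c + m%:R)) 1.
Proof.
move=> h1 h2 h3 h4.
suff : dual_cvg (fun m => gamma_ratio a b (c + m%:R)) (dual_exp 0) by rewrite dual_exp0.
pose L x m := dual_lnGamma (x + m%:R) - (Dual (lnGamma m%:R) 0 + x * Dual (ln m%:R) 0).
have hL x : dual_cvg (L x) 0 by exact: dual_lnGamma_asymp.
have e : (fun m => gamma_ratio a b (c + m%:R)) =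
    @dual_exp R \o (fun m => L (c - a) m + L (c - b) m + - L c m + - L (c - a - b) m).
  apply/funext => m /=.
  have m0 : 0 <= m%:R :> R by [].
  have ea : c + m%:R - a = c - a + m%:R by ring.
  have eb : c + m%:R - b = c - b + m%:R by ring.
  have eab : c + m%:R - a - b = c - a - b + m%:R by ring.
  rewrite gamma_ratio_exp ?eab ?ea ?eb.
  - by rewrite /L; congr dual_exp; ring.
  - by rewrite [dual_re _]dual_reD dual_re_nat ltr_pwDl.
  - by rewrite [dual_re _]dual_reD dual_re_nat ltr_pwDl.
  - by rewrite [dual_re _]dual_reD dual_re_nat ltr_pwDl.
  - by rewrite [dual_re _]dual_reD dual_re_nat ltr_pwDl.
rewrite e; apply: dual_cvg_exp.
rewrite (_ : 0 = 0 + 0 + - 0 + - 0 :> dualnum R); last by rewrite oppr0 !addr0.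
do 2 (apply: dual_cvgD; last exact: dual_cvgN).
by apply: dual_cvgD.
Qed.

Lemma exists_natr_gt (x : R) : exists n : nat, x < n%:R.
Proof.
by exists (Num.truncn x).+1; exact: truncnS_gt.
Qed.

(** Move [c] far enough to the right for both limits to apply; the product does not
change on the way. *)
Lemma gauss_sum_gamma_ratio a b c : nonpole (dual_re c) ->
  nonpole (dual_re (c - a)) -> nonpole (dual_re (c - b)) ->
  dual_re a + dual_re b < dual_re c ->
  gauss_sum a b c * gamma_ratio a b c = 1.
Proof.
move=> h1 h2 h3 h; have [d d0 hd] := exists_dual_scale h.
(* Once [c] is shifted by more than [bnd], all real parts involved are positive and
   the weighted dual part of [c] is at most half its real part. *)
pose bnd := `|dual_re a| + `|dual_re b| + `|dual_re c| + 2 * (d * `|dual_du c|).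
have [M hM] := exists_natr_gt bnd.
have dc0 : 0 <= d * `|dual_du c| by rewrite mulr_ge0// ltW.
have := ler_norm (dual_re a); have := ler_norm (- dual_re a).
have := ler_norm (dual_re b); have := ler_norm (- dual_re b).
have := ler_norm (- dual_re c); rewrite !normrN => nc nb1 nb na1 na.
have b0 := normr_ge0 (dual_re b); have a0 := normr_ge0 (dual_re a).
have c0 : 0 < dual_re (c + M%:R) by rewrite !dualE; rewrite /bnd in hM; lra.
rewrite -(gauss_sum_gamma_ratioDn M h1 h2 h3 h).
have h1' := nonpole_gt0 c0.
have ca0 : 0 < dual_re (c + M%:R - a) by rewrite !dualE; rewrite /bnd in hM; lra.
have cb0 : 0 < dual_re (c + M%:R - b) by rewrite !dualE; rewrite /bnd in hM; lra.
have M0 : 0 <= M%:R :> R by [].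
have cab0 : 0 < dual_re (c + M%:R - a - b) by rewrite !dualE; lra.
have h' : dual_re a + dual_re b < dual_re (c + M%:R) by rewrite !dualE; lra.
have duE : dual_du (c + M%:R) = dual_du c by rewrite !dualE addr0.
have dc : d * `|dual_du (c + M%:R)| <= dual_re (c + M%:R) / 2.
  by rewrite duE !dualE; rewrite /bnd in hM; lra.
have hd' : dual_re a + dual_re b + d * du_weight a b (c + M%:R) < dual_re (c + M%:R).
  by rewrite /du_weight duE -/(du_weight a b c) !dualE; lra.
have l1 := cvg_gauss_sum1 d0 c0 dc hd'.
have l2 := cvg_gamma_ratio c0 ca0 cb0 cab0.
have := dual_cvgM l1 l2; rewrite mulr1.
under eq_fun do rewrite (gauss_sum_gamma_ratioDn _ h1' (nonpole_gt0 ca0) (nonpole_gt0 cb0) h').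
exact: dual_cvg_unique (dual_cvg_cst _).
Qed.

End GaussTheorem.

Theorem mainTheorem10 (R : realType) (a1 a2 b1 : dualnum R)
  (hre : dual_re a1 + dual_re a2 < dual_re b1)
  (hb : forall n : nat, dual_re b1 <> - n%:R)
  (hb1 : forall n : nat, dual_re (b1 - a1) <> - n%:R)
  (hb2 : forall n : nat, dual_re (b1 - a2) <> - n%:R) :
  dual_cvgn (series (hyp2F1_term a1 a2 b1 1)) /\
  hyp2F1 a1 a2 b1 1 =
    dual_Gamma b1 * dual_Gamma (b1 - a1 - a2) /
    (dual_Gamma (b1 - a1) * dual_Gamma (b1 - a2)).
Proof.
split; first by have [] := dual_cvg_lim (gauss_series_cvg hb hre).
have hb12 : nonpole (dual_re (b1 - a1 - a2)).
  by apply: nonpole_gt0; rewrite !dualE; lra.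
have u : dual_Gamma (b1 - a1) * dual_Gamma (b1 - a2) \is a GRing.unit.
  by rewrite unitrM !unit_dual_Gamma.
apply: (mulIr u); rewrite divrK// -(gamma_ratioM hb hb12).
apply: (etrans (mulrA (gauss_sum a1 a2 b1) _ _)).
by rewrite gauss_sum_gamma_ratio// mul1r.
Qed.
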